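(* Let $n\ge 0$ and $g\ge 0$. The mapping $\Psi=\Lambda\circ\Delta$, which associates to a covered map $(M,S)$ the pair $(\Psi_1(M,S),\Psi_2(M,S))$, is a bijection between covered maps with $n$ edges and genus $g$ and pairs made of a rooted plane tree $\Psi_1(M,S)$ with $n$ edges and a rooted bipartite unicellular map $\Psi_2(M,S)$ with $n+1$ edges and genus $g$ (all maps considered up to isomorphism). Moreover, if the vertices of $\Psi_2(M,S)$ are colored white and black so that every edge joins a white and a black vertex and the root-vertex is white, then $\Psi_2(M,S)$ has $v(M)$ white vertices and $f(M)$ black vertices, where $v(M)$ and $f(M)$ are the numbers of vertices and faces of $M$.
   Context: Permutations are composed right to left: $(\sigma\alpha)(h)=\sigma(\alpha(h))$. A (rooted) map is a triple $M=(H,\sigma,\alpha)$ where $H$ is a finite set (half-edges), $\alpha$ is a fixed-point-free involution of $H$, $\sigma$ is a permutation of $H$, the group generated by $\sigma,\alpha$ acts transitively on $H$, together with a distinguished root $r\in H$. Maps are considered up to isomorphism: a bijection $\lambda:H\to H'$ with $\sigma'=\lambda\sigma\lambda^{-1}$, $\alpha'=\lambda\alpha\lambda^{-1}$, $\lambda(r)=r'$. The cycles of $\sigma$, $\alpha$, $\phi=\sigma\alpha$ are the vertices, edges and faces; with $v,e,f$ their numbers, the genus $g$ is defined by $v-e+f=2-2g$. The case $H=\emptyset$ is allowed and counts as a unicellular map of genus 0 with one vertex and no edge. A map is unicellular if it has one face; a plane tree is a unicellular map of genus $0$; a map is bipartite if its vertices can be 2-colored so that each edge joins vertices of different colors. For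 a permutation $\pi$ of $H$ and $S\subseteq H$, the restriction $\pi_{|S}$ is the permutation of $S$ whose cycles are obtained from those of $\pi$ by erasing the elements not in $S$ (it may be regarded as a permutation of $H$ fixing $H\setminus S$). A spanned map is a pair $(M,S)$ with $S\subseteq H$ stable under $\alpha$; its submap is $M_{|S}=(S,\sigma_{|S},\alpha_{|S})$. $(M,S)$ is a covered map if $M_{|S}$ is a connecting unicellular map: $\sigma_{|S},\alpha_{|S}$ act transitively on $S$, $S$ meets every cycle of $\sigma$ (except that $S=\emptyset$ is allowed when $M$ has a single vertex), and $\sigma_{|S}\alpha_{|S}$ has one cycle. The motion function is $\theta(h)=\sigma\alpha(h)$ if $h\in S$ and $\theta(h)=\sigma(h)$ otherwise; for a covered map it is a cyclic permutation of $H$, and the appearance order $\prec_S$ is the total order $r\prec_S\theta(r)\prec_S\theta^2(r)\prec_S\cdots\prec_S\theta^{|H|-1}(r)$. An orientation of $M$ is a partition $H=I\uplus O$ with $\alpha(I)=O$ ($I$ = ingoing half-edges). Step $\Delta$: $\Delta(M,S)=(M,(I,O))$ where $I=\{h\in S:\alpha(h)\prec_S h\}\cup\{h\notin S: h\prec_S\alpha(h)\}$ and $O=H\setminus I$. Step $\Lambda$ (unfolding) applied to $(M,(I,O))$ with $M=(H,\sigma,\alpha)$, root $r$, $\phi=\sigma\alpha$: take two new elements $i,o\notin H$, $H'=H\cup\{i,o\}$, $I'=I\cup\{i\}$, $O'=O\cup\{o\}$, $\alpha'$ the involution of $H'$ extending $\alpha$ with $\alpha'(i)=o$. Let $\sigma'$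 be obtained from $\sigma$ by inserting $i$ just before $r$ in the cycle of $r$ (i.e. $\sigma'(\sigma^{-1}(r))=i$, $\sigma'(i)=r$) and setting $\sigma'(o)=o$; let $\phi'$ be obtained from $\phi$ by inserting $o$ just before $r$ in its cycle and setting $\phi'(i)=i$. Let $\pi_\circ=\sigma'_{|I'}$ and $\pi_\bullet=\phi'_{|O'}$ (each regarded as a permutation of $H'$ acting as the identity outside $I'$, resp. $O'$), $\pi=\pi_\circ\pi_\bullet^{-1}$, $\tau'=\sigma'\pi_\circ^{-1}$, $\tau=\tau'_{|H}$. Then $\Lambda_1(M,(I,O))=A=(H,\tau,\alpha)$ with root $\tau'(i)$ and $\Lambda_2(M,(I,O))=B=(H',\pi,\alpha')$ with root $i$. Finally $\Psi_1=\Lambda_1\circ\Delta$, $\Psi_2=\Lambda_2\circ\Delta$. *)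

(* Defs.v *)
From mathcomp Require Import all_boot.
From mathcomp Require Import perm.

Set Implicit Arguments.
Unset Strict Implicit.
Unset Printing Implicit Defensive.

(* A (rooted) map on half-edges 'I_m: sigma, alpha, and the root.
   The root is [None] exactly when H is empty (m = 0). Permutations are
   plain functions; the validity predicate [is_map] requires bijectivity. *)
Record rmap (m : nat) := RMap {
  sigm : 'I_m -> 'I_m ;
  alpm : 'I_m -> 'I_m ;
  mroot : option 'I_m }.

Definition ncyc (T : finType) (f : T -> T) (A : {set T}) : nat :=
  #|[set froot f x | x in A]|.

Definition phim m (M : rmap m) : 'I_m -> 'I_m := fun h => sigm M (alpm M h).

Definition nverts m (M : rmap m) : nat :=
  if m == 0 then 1 else ncyc (sigm M) setT.
Definition nfaces m (M : rmap m) : nat :=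
  if m == 0 then 1 else ncyc (phim M) setT.
Definition nedges m (M : rmap m) : nat := m./2.

(* v - e + f = 2 - 2g, written in nat *)
Definition has_genus m (M : rmap m) (g : nat) : Prop :=
  nverts M + nfaces M + g.*2 = nedges M + 2.

Definition is_map m (M : rmap m) : Prop :=
  [/\ injective (sigm M),
      (forall h, alpm M (alpm M h) = h),
      (forall h, alpm M h != h),
      (forall x y, connect [rel a b | (b == sigm M a) || (b == alpm M a)] x y)
    & isSome (mroot M) = (0 < m)].

Definition is_unicellular m (M : rmap m) : Prop := is_map M /\ nfaces M = 1.
Definition is_plane_tree m (M : rmap m) : Prop :=
  is_unicellular M /\ has_genus M 0.

Definition proper_coloring m (M : rmap m) (col : 'I_m -> bool) : Prop :=
  (forall h, col (sigm M h) = col h) /\ (forall h, col (alpm M h) != col h).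
Definition is_bipartite m (M : rmap m) : Prop :=
  is_map M /\ exists col, proper_coloring M col.

Definition ncol_verts m (M : rmap m) (col : 'I_m -> bool) (b : bool) : nat :=
  ncyc (sigm M) [set h | col h == b].

(* restriction pi_{|S}: cycles with elements outside S erased; identity
   outside S *)
Definition restr (T : finType) (f : T -> T) (S : {set T}) (h : T) : T :=
  if h \in S then
    let s := traject f (f h) #|T| in nth h s (find (fun x => x \in S) s)
  else h.

Definition alpha_stable m (M : rmap m) (S : {set 'I_m}) : Prop :=
  forall h, h \in S -> alpm M h \in S.

Definition is_covered m (M : rmap m) (S : {set 'I_m}) : Prop :=
  [/\ is_map M, alpha_stable M S,
      (forall x y, x \in S -> y \in S ->
         connect [rel a b | (b == restr (sigm M) S a) || (b == restr (alpm M) S a)] x y),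
      (forall h, exists2 h', h' \in S & fconnect (sigm M) h h')
        \/ (S = set0 /\ nverts M = 1)
    & (forall x y, x \in S -> y \in S ->
         fconnect (fun h => restr (sigm M) S (restr (alpm M) S h)) x y)].

Definition theta m (M : rmap m) (S : {set 'I_m}) (h : 'I_m) : 'I_m :=
  if h \in S then sigm M (alpm M h) else sigm M h.

Definition prec m (M : rmap m) (S : {set 'I_m}) (r x y : 'I_m) : bool :=
  findex (theta M S) r x < findex (theta M S) r y.

(* Step Delta: the set I of ingoing half-edges *)
Definition Delta m (M : rmap m) (S : {set 'I_m}) : {set 'I_m} :=
  match mroot M with
  | Some r => [set h | if h \in S then prec M S r (alpm M h) h
                       else prec M S r h (alpm M h)]
  | None => set0
  end.

(* Step Lambda: H' = 'I_(m.+2), H embedded as {0..m-1}, i = m, o = m+1 *)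
Section Lambda.
Variables (m : nat) (M : rmap m) (I : {set 'I_m}).

Definition Hi : 'I_m.+2 := inord m.
Definition Ho : 'I_m.+2 := inord m.+1.
Definition emb (h : 'I_m) : 'I_m.+2 := inord h.
Definition dec (h' : 'I_m.+2) : option 'I_m := insub (val h').

Definition sigp (h' : 'I_m.+2) : 'I_m.+2 :=
  match dec h' with
  | Some h => if Some (sigm M h) == mroot M then Hi else emb (sigm M h)
  | None => if h' == Hi then (if mroot M is Some r then emb r else Hi) else h'
  end.

Definition phip (h' : 'I_m.+2) : 'I_m.+2 :=
  match dec h' with
  | Some h => if Some (phim M h) == mroot M then Ho else emb (phim M h)
  | None => if h' == Ho then (if mroot M is Some r then emb r else Ho) else h'
  end.

Definition alpp (h' : 'I_m.+2) : 'I_m.+2 :=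
  match dec h' with
  | Some h => emb (alpm M h)
  | None => if h' == Hi then Ho else Hi
  end.

Definition Ip : {set 'I_m.+2} := emb @: I :|: [set Hi].
Definition Op : {set 'I_m.+2} := ~: Ip.
Definition pic := restr sigp Ip.
Definition pib := restr phip Op.
Definition piL (h' : 'I_m.+2) : 'I_m.+2 := pic (finv pib h').
Definition taup (h' : 'I_m.+2) : 'I_m.+2 := sigp (finv pic h').
Definition Hset : {set 'I_m.+2} := [set h' : 'I_m.+2 | val h' < m].
Definition tauL (h : 'I_m) : 'I_m := odflt h (dec (restr taup Hset (emb h))).

Definition Lambda1 : rmap m := RMap tauL (alpm M) (dec (taup Hi)).
Definition Lambda2 : rmap m.+2 := RMap piL alpp (Some Hi).
End Lambda.

Definition Psi1 m (M : rmap m) (S : {set 'I_m}) : rmap m := Lambda1 M (Delta M S).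
Definition Psi2 m (M : rmap m) (S : {set 'I_m}) : rmap m.+2 := Lambda2 M (Delta M S).

Definition map_iso m (M M' : rmap m) : Prop :=
  exists l : {perm 'I_m},
    [/\ forall h, l (sigm M h) = sigm M' (l h),
        forall h, l (alpm M h) = alpm M' (l h)
      & omap l (mroot M) = mroot M'].

Definition covered_iso m (M : rmap m) (S : {set 'I_m}) (M' : rmap m) (S' : {set 'I_m}) : Prop :=
  exists l : {perm 'I_m},
    [/\ forall h, l (sigm M h) = sigm M' (l h),
        forall h, l (alpm M h) = alpm M' (l h),
        omap l (mroot M) = mroot M'
      & l @: S = S'].

Definition covered_ng (n g : nat) (M : rmap n.*2) (S : {set 'I_n.*2}) : Prop :=
  is_covered M S /\ has_genus M g.

(* Main.v *)
Require Import Defs.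
From mathcomp Require Import all_boot.
From mathcomp Require Import perm.

(**
  Put H' = H + {i, o} and t = tau' alpha'.  Each cycle of tau' = sigma' pi_white^-1
  other than (o) contains exactly one ingoing half-edge, so A is a plane tree with
  n edges as soon as t is cyclic.  For a covered map theta = sigma alpha_S is
  cyclic, and sigma(h) comes right after the later half of the edge of h when h is
  outgoing: following outgoing half-edges strictly increases the appearance order
  of edges, so all leftmost paths reach the root and t is cyclic.

  Since phi' skips exactly the ingoing half-edges met by t, on outgoing half-edges
  pi_black = t_|O alpha pi_white alpha.  This says that the face tour of B lists
  the edges in the reverse of the order in which the tour of A discovers them: B
  is unicellular, and A and B together determine how their edges are glued, hence
  sigma' = tau' pi_white and the orientation.  Conversely gluing an arbitrary tree
  to an arbitrary B in this way yields an oriented map.  Finally S is recovered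
  from the orientation by a walk that at each step reads off from the orientation
  and from the edges already visited whether the current half-edge is in S; the
  walk can only close up at the root, and left-connectedness forces it to visit
  every half-edge.
*)

Set Implicit Arguments.
Unset Strict Implicit.
Unset Printing Implicit Defensive.

(** * First returns and cycle counts *)

Definition cyclic_on (T : finType) (f : T -> T) : Prop :=
  forall x y, fconnect f x y.

Section FirstReturn.
Variable T : finType.
Implicit Types (f g : T -> T) (S A B : {set T}) (x y h : T).

(** The relational form of the search inside [restr]: for [f] injective and [h \in S], [restr f S h]
    is the only [y] with [hit f S (f h) y]. First returns are then handled by induction on the
    path. *)
Inductive hit f S : T -> T -> Prop :=
| hit_here x : x \in S -> hit f S x x
| hit_next x y : x \notin S -> hit f S (f x) y -> hit f S x y.

Lemma hit_in f S x y : hit f S x y -> y \in S.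
Proof. by elim. Qed.

Lemma hit_det f S x y z : hit f S x y -> hit f S x z -> y = z.
Proof.
move=> H; elim: H z => {x y} [x xS|x y xS _ IH] z H; inversion H; subst=> //.
- by case/negP: H0.
- by case/negP: xS.
- exact: IH.
Qed.

Lemma hit_connect f S x y : hit f S x y -> fconnect f x y.
Proof.
elim=> {x y} // x y _ _; apply: connect_trans; exact: fconnect1.
Qed.

(** The path applies [f] only outside [S]. This compares [tau] with [sigma], equal off [I], and
    [theta] with [sigma], equal off [S]. *)
Lemma hit_eq_off f g S x y :
  (forall h, h \notin S -> f h = g h) -> hit f S x y -> hit g S x y.
Proof.
move=> fg; elim=> {x y} [x xS|x y xS _ IH]; first exact: hit_here.
by apply: hit_next => //; rewrite -fg.
Qed.

Lemma hitP f S x y :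
  hit f S x y <->
  exists k, [/\ y = iter k f x, y \in S
              & forall j, j < k -> iter j f x \notin S].
Proof.
split.
  elim=> {x y} [x xS|x y xS _ [k [-> kS km]]]; first by exists 0.
  exists k.+1; rewrite iterSr; split=> // -[|j] //; rewrite ltnS iterSr.
  exact: km.
case=> k [-> {y}]; elim: k x => [|k IH] x kS km; first exact: hit_here.
apply: hit_next; first exact: (km 0).
rewrite iterSr; apply: IH; first by rewrite -iterSr.
by move=> j jk; rewrite -iterSr; apply: km.
Qed.

Lemma restr_out f S h : h \notin S -> restr f S h = h.
Proof. by rewrite /restr => /negPf->. Qed.

Lemma restr_hit f S h : injective f -> h \in S -> hit f S (f h) (restr f S h).
Proof.
move=> fI hS; rewrite /restr hS.
(* The orbit is back at [h] after [order f h <= #|T|] steps, so the search succeeds and the default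
   of [nth] is never returned. *)
have: has (mem S) (traject f (f h) #|T|).
  apply/hasP; exists h => //; apply/trajectP; exists (order f h).-1.
    by rewrite orderSpred; exact: max_card.
  by rewrite -iterSr orderSpred iter_order.
elim: #|T| (f h) => //= n IH x.
case: ifPn => xS; first by move=> _; exact: hit_here.
by move=> /IH; apply: hit_next.
Qed.

Lemma restr_eq f S h y :
  injective f -> h \in S -> hit f S (f h) y -> restr f S h = y.
Proof. by move=> fI hS; apply: hit_det; apply: restr_hit. Qed.

Lemma restr_in f S h : injective f -> h \in S -> restr f S h \in S.
Proof. by move=> fI hS; apply: hit_in (restr_hit fI hS). Qed.

Lemma restr_inE f S h : injective f -> (restr f S h \in S) = (h \in S).
Proof.
move=> fI; have [hS|hS] := boolP (h \in S); first exact: restr_in.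
by rewrite restr_out // (negPf hS).
Qed.

Lemma restr_step f S h : h \in S -> f h \in S -> restr f S h = f h.
Proof.
move=> hS fhS; rewrite /restr hS.
case: #|T| (max_card (pred1 h)) => [|n _] /=; first by rewrite card1.
by rewrite fhS.
Qed.

Lemma iter_inj_fun f k : injective f -> injective (iter k f).
Proof. by move=> fI; elim: k => //= k IH x y /fI/IH. Qed.

Lemma restr_inj f S : injective f -> injective (restr f S).
Proof.
move=> fI x y; have [xS|xS] := boolP (x \in S); last first.
  rewrite (restr_out _ xS); have [yS|yS] := boolP (y \in S).
    by move=> E; case/negP: xS; rewrite E restr_in.
  by rewrite restr_out.
have [yS|yS] := boolP (y \in S); last first.
  by rewrite (restr_out _ yS) => E; case/negP: yS; rewrite -E restr_in.
move=> E; have := restr_hit fI xS; have := restr_hit fI yS; rewrite -{}E.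
move: (restr f S x) => z /hitP[k [zk _ km]] /hitP[l [zl _ lm]].
(* Cancel the shorter of two paths to the same point: if the lengths differed, the longer path would
   have met [u \in S] too early. *)
have main : forall u v k l, u \in S -> v \in S -> k <= l ->
    (forall j, j < l -> iter j f (f v) \notin S) ->
    iter k f (f u) = iter l f (f v) -> u = v.
  move=> {x y xS yS z k l zk km zl lm} u v k l uS vS kl lm.
  rewrite -(subnK kl) addnC iterD => /(iter_inj_fun fI).
  case: (l - k) (subnK kl) => [_ /= /fI //|d dk /=  /fI uE].
  by have := lm d; rewrite -uE uS -dk -{1}(addn0 d) addSn ltnS leq_add2l => /(_ isT).
by case/orP: (leq_total k l) => kl; [symmetry; apply: (main _ _ k l)|
   apply: (main _ _ l k)] => //; rewrite -zk -zl.
Qed.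

Lemma restr_connect f S x y : injective f -> x \in S -> y \in S ->
  fconnect (restr f S) x y = fconnect f x y.
Proof.
move=> fI xS yS; apply/idP/idP.
  apply: connect_sub => {xS yS y}x _ /eqP<-.
  have [xS|xS] := boolP (x \in S); last by rewrite restr_out.
  apply: connect_trans (fconnect1 f x) _.
  exact: hit_connect (restr_hit fI xS).
move=> /iter_findex; move: (findex f x y) => k.
elim/ltn_ind: k x xS => -[|k] IH x xS kE; first by rewrite -kE connect0.
have := restr_hit fI xS => /hitP[j [jE jS jm]].
(* The first return cannot overshoot [y], which lies in [S]. *)
have jk : j <= k.
  rewrite leqNgt; apply/negP => /jm; rewrite -iterSr kE yS //.
apply: connect_trans (fconnect1 _ x) _.
apply: (IH (k - j)); first by rewrite ltnS leq_subr.
  by [].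
by rewrite jE -iterD subnK // -iterSr.
Qed.

Lemma eq_restr f g S : f =1 g -> restr f S =1 restr g S.
Proof.
move=> fg h; rewrite /restr.
have -> : traject f (f h) #|T| = traject g (g h) #|T|; last by [].
by rewrite -fg; elim: #|T| (f h) => //= n IH x; rewrite IH fg.
Qed.

Lemma froot_eq f x y : injective f -> (froot f x == froot f y) = fconnect f x y.
Proof. by move=> fI; apply: root_connect; apply: fconnect_sym. Qed.

Lemma eq_ncyc f g S : injective f -> injective g -> f =1 g -> ncyc f S = ncyc g S.
Proof.
move=> fI gI fg; rewrite /ncyc; congr #|pred_of_set _|; apply: eq_imset => x.
rewrite /root; congr odflt; apply: eq_pick => y; exact: (eq_fconnect fg).
Qed.

Lemma ncyc_cyclic f S : injective f -> (forall x y, x \in S -> y \in S -> fconnect f x y) ->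
  S != set0 -> ncyc f S = 1.
Proof.
move=> fI cf /set0Pn[z zS]; rewrite /ncyc -(cards1 (froot f z)); congr #|pred_of_set _|.
apply/setP=> x; rewrite inE; apply/imsetP/eqP => [[y yS ->]|->]; last by exists z.
by apply/eqP; rewrite froot_eq // cf.
Qed.

Lemma ncyc_setU f A B : injective f ->
  (forall x y, x \in A -> y \in B -> ~~ fconnect f x y) ->
  ncyc f (A :|: B) = ncyc f A + ncyc f B.
Proof.
move=> fI AB; rewrite /ncyc imsetU cardsU.
rewrite [_ :&: _](_ : _ = set0) ?cards0 ?subn0 //.
apply/setP=> x; rewrite !inE; apply/negP => /andP[/imsetP[a aA ->]] /imsetP[b bB] /eqP.
by rewrite froot_eq //; apply/negP; apply: AB.
Qed.

Lemma ncyc_transversal f A B : injective f -> B \subset A ->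
  (forall x, x \in A -> exists2 b, b \in B & fconnect f x b) ->
  {in B &, forall x y, fconnect f x y -> x = y} -> ncyc f A = #|B|.
Proof.
move=> fI /subsetP BA AB BI; rewrite -(card_in_imset (f := froot f) (D := B)).
  congr #|pred_of_set _|; apply/setP=> z; apply/imsetP/imsetP => -[x xA ->].
    by case: (AB x xA) => b bB xb; exists b => //; apply/eqP; rewrite froot_eq.
  by exists x => //; apply: BA.
by move=> x y xB yB /eqP; rewrite froot_eq //; apply: BI.
Qed.

(** Pigeonhole: [froot f] maps [B] onto the roots of [A], which are as many as the elements of
    [B]. *)
Lemma ncyc_unique f A B : injective f -> B \subset A ->
  (forall x, x \in A -> exists2 b, b \in B & fconnect f x b) ->
  ncyc f A = #|B| -> {in B &, forall x y, fconnect f x y -> x = y}.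
Proof.
move=> fI /subsetP BA AB cE x y xB yB xy.
have /imset_injP : #|froot f @: B| == #|B|.
  rewrite -cE; apply/eqP; congr #|pred_of_set _|.
  apply/setP=> z; apply/imsetP/imsetP => -[u uA ->]; first by exists u; rewrite ?BA.
  by case: (AB u uA) => b bB ub; exists b => //; apply/eqP; rewrite froot_eq.
by move/(_ x y xB yB); apply; apply/eqP; rewrite froot_eq.
Qed.

Lemma connect_finv f x y : injective f -> fconnect (finv f) x y = fconnect f x y.
Proof. by move=> fI; rewrite (same_fconnect_finv fI). Qed.

Lemma hit_exists f S x y : fconnect f x y -> y \in S -> exists z, hit f S x z.
Proof.
move=> /iter_findex; move: (findex f x y) => n; elim: n x => [|n IH] x /=.
  by move=> -> yS; exists y; apply: hit_here.
rewrite -iterS iterSr => E yS; have [xS|xS] := boolP (x \in S).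
  by exists x; apply: hit_here.
by case: (IH _ E yS) => z Hz; exists z; apply: hit_next.
Qed.

Lemma eq_in_fconnect f g S x y : {in S, f =1 g} -> {in S, forall z, f z \in S} ->
  x \in S -> fconnect f x y = fconnect g x y.
Proof.
move=> fg fS xS.
have E k : iter k f x = iter k g x /\ iter k f x \in S.
  by elim: k => //= k [<- kS]; rewrite fg // -fg // fS.
apply/idP/idP => /iter_findex<-; first by rewrite (E _).1 fconnect_iter.
by rewrite -(E _).1 fconnect_iter.
Qed.

Lemma ncyc1_cyclic f : injective f -> ncyc f setT = 1 -> cyclic_on f.
Proof.
move=> fI /eqP/cards1P[z zE] x y; rewrite -froot_eq //.
have R u : froot f u = z by apply/set1P; rewrite -zE; apply/imsetP; exists u.
by rewrite !R.
Qed.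

End FirstReturn.

(** * Positions along a cyclic permutation *)

Section CyclicIndex.
Variables (T : finType) (f : T -> T) (r : T).
Hypotheses (fI : injective f) (fC : cyclic_on f).

Lemma cyclic_iter_index x : iter (findex f r x) f r = x.
Proof. exact: iter_findex (fC _ _). Qed.

Lemma cyclic_index_inj : injective (findex f r).
Proof. by move=> x y E; rewrite -(cyclic_iter_index x) E cyclic_iter_index. Qed.

Lemma order_cyclic : order f r = #|T|.
Proof. by apply: eq_card => x; rewrite !inE fC. Qed.

Lemma cyclic_index_lt x : findex f r x < #|T|.
Proof. by rewrite -order_cyclic; exact: findex_max (fC _ _). Qed.

Lemma cyclic_index_step x : f x != r -> findex f r (f x) = (findex f r x).+1.
Proof.
move=> fxr; have E : f x = iter (findex f r x).+1 f r by rewrite /= cyclic_iter_index.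
rewrite {1}E findex_iter //; move: (cyclic_index_lt x); rewrite -order_cyclic.
rewrite leq_eqVlt => /orP[/eqP F|//]; case/eqP: fxr.
by rewrite E F iter_order.
Qed.

Lemma cyclic_index_iter k : k < #|T| -> findex f r (iter k f r) = k.
Proof. by move=> kT; rewrite findex_iter // order_cyclic. Qed.

End CyclicIndex.

(** * Transport along an injection *)

Section Transport.
Variables (T U : finType) (l : T -> U).
Hypothesis lI : injective l.
Implicit Types (f : T -> T) (g : U -> U).

Lemma iter_conj f g : (forall h, l (f h) = g (l h)) ->
  forall k h, l (iter k f h) = iter k g (l h).
Proof. by move=> fg; elim=> //= k IH h; rewrite fg IH. Qed.

Lemma fconnect_conj f g x y : (forall h, l (f h) = g (l h)) ->
  fconnect g (l x) (l y) = fconnect f x y.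
Proof.
move=> fg; apply/idP/idP => /iter_findex.
  by rewrite -(iter_conj fg) => /lI <-; apply: fconnect_iter.
by move<-; rewrite (iter_conj fg) fconnect_iter.
Qed.

Lemma hit_conj f g (S : {set T}) (S' : {set U}) x y :
  (forall h, l (f h) = g (l h)) -> (forall h, (l h \in S') = (h \in S)) ->
  hit f S x y -> hit g S' (l x) (l y).
Proof.
move=> fg lS; elim=> {x y} [x xS|x y xS _ IH].
  by apply: hit_here; rewrite lS.
by apply: hit_next; rewrite ?lS // -fg.
Qed.

Lemma restr_conj f g (S : {set T}) (S' : {set U}) : injective f -> injective g ->
  (forall h, l (f h) = g (l h)) -> (forall h, (l h \in S') = (h \in S)) ->
  forall h, l (restr f S h) = restr g S' (l h).
Proof.
move=> fI gI fg lS h; have [hS|hS] := boolP (h \in S); last first.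
  by rewrite !restr_out ?lS.
symmetry; apply: restr_eq => //; first by rewrite lS.
by rewrite -fg; apply: hit_conj fg lS _; apply: restr_hit.
Qed.

Lemma finv_conj f g : injective f -> injective g ->
  (forall h, l (f h) = g (l h)) -> forall h, l (finv f h) = finv g (l h).
Proof. by move=> fI gI fg h; apply: (gI); rewrite -fg (f_finv fI) (f_finv gI). Qed.

Lemma findex_conj f g x y : (forall h, l (f h) = g (l h)) -> fconnect f x y ->
  findex g (l x) (l y) = findex f x y.
Proof.
move=> fg xy; rewrite -{1}(iter_findex xy) (iter_conj fg) findex_iter //.
apply: leq_trans (findex_max xy) _.
rewrite /order -(card_image lI); apply: subset_leq_card; apply/subsetP => z /imageP[w xw ->].
by rewrite inE (fconnect_conj _ _ fg).
Qed.

(** Orbits are compared rather than [f] conjugated to [g], so that [l] may be the identity between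
    two different permutations inducing the same classes on [A]. *)
Lemma ncyc_conj f g (A : {set T}) (B : {set U}) : injective f -> injective g ->
  {in A &, forall x y, fconnect g (l x) (l y) = fconnect f x y} ->
  (forall x, x \in A -> l x \in B) ->
  (forall y, y \in B -> exists2 x, x \in A & fconnect g y (l x)) ->
  ncyc g B = ncyc f A.
Proof.
move=> fI gI fg AB BA.
(* The root of a cycle may lie outside [A]; [pk] replaces it by a representative inside. *)
pose pk z := odflt z [pick x in A | froot f x == z].
have pkP x : x \in A -> pk (froot f x) \in A /\ fconnect f (pk (froot f x)) x.
  move=> xA; rewrite /pk; case: pickP => [y /andP[yA]|/(_ x)] /=.
    by rewrite froot_eq.
  by rewrite xA eqxx.
have -> : ncyc f A = ncyc g (l @: A).
  rewrite /ncyc -(card_in_imset (f := fun z => froot g (l (pk z)))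
                   (D := [set froot f x | x in A])).
    congr #|pred_of_set _|; rewrite -!imset_comp; apply: eq_in_imset => x xA /=.
    case: (pkP x xA) => pA px; apply/eqP.
    by rewrite froot_eq // fg.
  move=> _ _ /imsetP[x xA ->] /imsetP[y yA ->] /eqP; rewrite froot_eq //.
  case: (pkP x xA) => pxA px; case: (pkP y yA) => pyA py; rewrite fg // => xy.
  apply/eqP; rewrite froot_eq //; apply: connect_trans (connect_trans xy py).
  by rewrite fconnect_sym.
rewrite /ncyc; congr #|pred_of_set _|; apply/setP=> z.
apply/imsetP/imsetP => -[x xA ->].
  case: (BA x xA) => w wA xw; exists (l w); first by apply/imsetP; exists w.
  by apply/eqP; rewrite froot_eq.
by case/imsetP: xA => w wA ->; exists (l w); rewrite ?AB.
Qed.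

End Transport.

(** * Unfolding on the extended set of half-edges *)

Lemma card_swapped (X : finType) (a : X -> X) (I : {set X}) :
  involutive a -> (forall x, (a x \in I) = (x \notin I)) -> #|I|.*2 = #|X|.
Proof.
move=> aK aI; rewrite -(cardC (mem I)) -addnn; congr (_ + _).
rewrite -(card_imset (mem I) (inv_inj aK)); apply: eq_card => x.
rewrite !inE; apply/imsetP/idP => [[y yI ->]|xI]; first by rewrite aI yI.
by exists (a x); rewrite ?aK // aI.
Qed.

Section Unfolding.
Variables (X : finType) (s a phi : X -> X) (i o : X) (I : {set X}).
Hypotheses (sI : injective s) (aK : involutive a) (phiI : injective phi).
Hypotheses (aI : forall x, (a x \in I) = (x \notin I)) (ai : a i = o).
Hypotheses (iI : i \in I) (so : s o = o).
Hypothesis phiE : forall x, phi x = tperm i o (s (a x)).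

(** [pw] and [pb] are pi_white and pi_black, [tau] is tau', [t] is the tour of the tree with the
    root edge attached, and [beta] is the face permutation of the bipartite map. *)
Let O := ~: I.
Let pw := restr s I.
Let pb := restr phi O.
Let tau x := s (finv pw x).
Let t x := tau (a x).
Let beta x := pw (finv pb (a x)).

Let pwI : injective pw. Proof. exact: restr_inj. Qed.
Let pbI : injective pb. Proof. exact: restr_inj. Qed.

Lemma unfolded_inj : injective tau.
Proof. by move=> x y /sI/(finv_inj pwI). Qed.

Lemma finv_restr_out x : x \notin I -> finv pw x = x.
Proof. by move=> xI; apply: pwI; rewrite f_finv // /pw restr_out. Qed.

Lemma unfolded_out x : x \notin I -> tau x = s x.
Proof. by move=> xI; rewrite /tau finv_restr_out. Qed.

Lemma unfolded_restr x : tau (pw x) = s x.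
Proof. by rewrite /tau finv_f. Qed.

Lemma o_notin : o \notin I.
Proof. by rewrite -aI -ai aK. Qed.

Lemma a_o : a o = i. Proof. by rewrite -ai aK. Qed.

Lemma tour_inj : injective t.
Proof. by move=> x y /unfolded_inj/(inv_inj aK). Qed.

(* [phi] follows the tour [t] as long as it runs through ingoing half-edges,
   the transposition (i o) fast-forwarding over the corner at [i]. *)
Lemma hit_tour x y : x != o -> hit t O x y -> hit phi O (tperm i o x) y.
Proof.
move=> + H; elim: H => {x y} [x xO xo|x y xO Ht IH xo].
  rewrite tpermD 1?eq_sym //; first exact: hit_here.
  by apply/eqP => xi; move: xO; rewrite inE xi iI.
have xI : x \in I by move: xO; rewrite inE negbK.
have axI : a x \notin I by rewrite aI xI.
have [xi|xi] := eqVneq x i.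
  have oO : o \in O by rewrite inE o_notin.
  rewrite xi tpermL; suff <- : o = y by exact: hit_here.
  apply: (hit_det _ Ht); rewrite /t xi ai unfolded_out ?o_notin // so.
  exact: hit_here.
rewrite tpermD 1?eq_sym //; apply: hit_next => //.
have tx : t x = s (a x) by rewrite /t unfolded_out.
rewrite phiE -tx; apply: IH; rewrite tx; apply: contra_neq xi => E.
by apply: (inv_inj aK); rewrite ai; apply: sI; rewrite E so.
Qed.

(** Up to the transposition, [phi h] is [s (a h) = t (a (pw (a h)))]; [hit_tour] turns the first
    return of [t] from there into that of [phi]. *)
Lemma black_tour h : h \notin I -> pb h = restr t O (a (pw (a h))).
Proof.
move=> hI; have hO : h \in O by rewrite inE.
have ahI : a h \in I by rewrite aI hI.
apply: restr_eq => //; rewrite phiE.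
have tE : t (a (pw (a h))) = s (a h) by rewrite /t aK unfolded_restr.
apply: hit_tour; first by apply: contraNneq o_notin => E; rewrite -(sI (etrans E (esym so))).
rewrite -tE; apply: restr_hit; first exact: tour_inj.
by rewrite inE aI negbK; apply: restr_in.
Qed.

Lemma face_in x : x \in I -> beta x = finv pb (a x) /\ beta x \notin I.
Proof.
move=> xI; have axI : a x \notin I by rewrite aI xI.
have fI : finv pb (a x) \notin I.
  have := restr_inE O (finv pb (a x)) phiI; rewrite -/pb f_finv // !inE axI.
  by move<-.
by rewrite /beta /pw restr_out.
Qed.

Lemma face_out x : x \notin I -> beta x = pw (a x) /\ beta x \in I.
Proof.
move=> xI; have axI : a x \in I by rewrite aI.
suff E : finv pb (a x) = a x by rewrite /beta E; split=> //; apply: restr_in.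
by apply: pbI; rewrite f_finv // /pb restr_out // inE axI.
Qed.

(* Hence the face tour of [B] visits the edges in the reverse of the order in
   which the tour of the tree discovers them. *)
Lemma tour_face x : x \in I -> restr t O (a (beta (beta x))) = a x.
Proof.
move=> xI; have [b1 b1I] := face_in xI; have [-> _] := face_out b1I.
by rewrite -black_tour // b1 f_finv.
Qed.

Lemma face_inj : injective beta.
Proof. by move=> x y /pwI/(finv_inj pbI)/(inv_inj aK). Qed.

(** On [I], [beta \o beta] is conjugate under [a] to the inverse of [restr t O] by [tour_face], and
    the latter is cyclic on [O]; any other half-edge enters [I] after one step of [beta]. *)
Lemma face_cyclic : cyclic_on t -> cyclic_on beta.
Proof.
move=> tC; have bs := fconnect_sym face_inj.
have II x y : x \in I -> y \in I -> fconnect beta x y.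
  move=> xI yI.
  have : fconnect (restr t O) (a x) (a y).
    by rewrite restr_connect ?inE ?aI ?xI ?yI //; apply: tour_inj.
  move/iter_findex; move: (findex _ _ _) => k.
  elim: k y yI => [|k IH] y yI /=; first by move/(inv_inj aK)->; apply: connect0.
  have [b1 b1I] := face_in yI; have [_ b2I] := face_out b1I.
  rewrite -(tour_face yI) => /(restr_inj tour_inj)/(IH _ b2I) xb.
  apply: connect_trans xb _; rewrite bs.
  exact: connect_trans (fconnect1 _ _) (fconnect1 _ _).
have XI x : exists2 y, y \in I & fconnect beta x y.
  have [xI|xI] := boolP (x \in I); first by exists x; rewrite ?connect0.
  by exists (beta x); [case: (face_out xI)|exact: fconnect1].
move=> x y; case: (XI x) (XI y) => u uI xu [v vI yv].
by apply: connect_trans xu (connect_trans (II _ _ uI vI) _); rewrite bs.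
Qed.

Let pi x := pw (finv pb x).

Lemma pi_white x : x \in I -> pi x = pw x.
Proof.
move=> xI; rewrite /pi; congr pw; apply: pbI.
by rewrite f_finv // /pb restr_out // inE xI.
Qed.

Lemma pi_black x : x \notin I -> pi x = finv pb x /\ pi x \notin I.
Proof. by move=> xI; have := @face_in (a x); rewrite aI xI /beta aK => /(_ isT). Qed.

Lemma pi_color x : (pi x \in I) = (x \in I).
Proof.
have [xI|xI] := boolP (x \in I); first by rewrite pi_white // restr_in.
by case: (pi_black xI) => _ /negPf.
Qed.

Lemma pi_inj : injective pi.
Proof. by move=> x y /pwI/(finv_inj pbI). Qed.

(** On [I], [pi] is the restriction of [s], and every cycle of [s] except the fixed point [o] meets
    [I]. *)
Lemma white_count : (forall x, x != o -> exists2 y, y \in I & fconnect s x y) ->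
  ncyc s (~: [set o]) = ncyc pi I.
Proof.
move=> sC; apply: (ncyc_conj (l := id)); [exact: pi_inj|exact: sI| | |].
- move=> x y xI yI /=; rewrite -(restr_connect sI xI yI); symmetry.
  apply: (eq_in_fconnect (S := I)) => // z zI; first exact: pi_white.
  by rewrite pi_color.
- move=> x xI; rewrite !inE; apply: contraTneq xI => ->; exact: o_notin.
- by move=> x; rewrite !inE => /sC.
Qed.

(** On [O], [pi] is the inverse of the restriction of [phi], and inversion preserves orbits. *)
Lemma black_count : (forall x, x != i -> exists2 y, y \notin I & fconnect phi x y) ->
  ncyc phi (~: [set i]) = ncyc pi O.
Proof.
move=> sC; apply: (ncyc_conj (l := id)); [exact: pi_inj|exact: phiI| | |].
- move=> x y xI yI /=; rewrite -(restr_connect phiI xI yI) -/pb -(connect_finv _ _ pbI).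
  symmetry; apply: (eq_in_fconnect (S := O)) => // z; rewrite inE => zI.
    by case: (pi_black zI).
  by rewrite inE pi_color.
- move=> x; rewrite !inE; apply: contraNneq => ->; exact: iI.
- by move=> x; rewrite !inE => /sC[y yI xy]; exists y; rewrite ?inE.
Qed.

Lemma unfolded_first_return x : x \in I -> hit s I (s (finv pw x)) x.
Proof.
move=> xI; rewrite -{2}(f_finv pwI x); apply: restr_hit => //.
by have := restr_inE I (finv pw x) sI; rewrite -/pw f_finv // xI.
Qed.

(** From [tau x], the first point of [I] met by [s] is [x] again; as [tau] equals [s] off [I],
    [restr tau I] is the identity. *)
Lemma unfolded_one_per_cycle : {in I &, forall x y, fconnect tau x y -> x = y}.
Proof.
move=> x y xI yI; rewrite -(restr_connect unfolded_inj xI yI).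
have rI z : z \in I -> restr tau I z = z.
  move=> zI; apply: restr_eq => //; first exact: unfolded_inj.
  apply: hit_eq_off (unfolded_first_return zI) => h hI.
  by rewrite unfolded_out.
by move/iter_findex<-; elim: (findex _ _ _) => //= n <-; rewrite rI.
Qed.

Lemma unfolded_count :
  (forall x, x != o -> exists2 y, y \in I & fconnect s x y) ->
  ncyc tau (~: [set o]) = #|I|.
Proof.
move=> sC; apply: ncyc_transversal; first exact: unfolded_inj.
- apply/subsetP => x xI; rewrite !inE; apply: contraTneq xI => ->.
  exact: o_notin.
- move=> x; rewrite !inE => /sC[y yI /hit_exists/(_ yI)[z Hz]].
  exists z; first exact: hit_in Hz.
  apply: (hit_connect (S := I)); apply: hit_eq_off Hz => h hI.
  by rewrite unfolded_out.
exact: unfolded_one_per_cycle.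
Qed.

(* [mu] increases along the leftmost paths, so these all end at the root. *)
Lemma tour_cyclic (mu : X -> nat) : (forall x, mu (a x) = mu x) ->
  (forall x, x \notin I -> x != o -> mu x < mu (s x)) ->
  (forall x, mu x <= mu i) -> cyclic_on t.
Proof.
move=> mua mus mui; have ts := fconnect_sym tour_inj.
have sno x : x != o -> s x != o.
  by apply: contra_neq => E; apply: sI; rewrite E so.
have tE x : x \notin I -> t (a x) = s x by move=> xI; rewrite /t aK unfolded_out.
have xax x : x \in I -> fconnect t x (a x).
  have [k] := ubnP (mu x); elim: k x => // k IH x; rewrite ltnS => xk xI.
  (* The path from [tau x = t (a x)] back to [x] runs through outgoing half-edges with [mu] below
     [mu x]. By induction the tour joins the two halves of each of their edges, hence also
     consecutive points of the path. *)
  have chain y z : hit s I y z -> z = x -> y != o -> mu y <= mu x /\ fconnect t y x.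
    elim=> {y z} [z _ ->|y z yI _ IHy zx yo]; first by rewrite leqnn connect0.
    have [m1 c1] := IHy zx (sno _ yo); have m2 := leq_trans (mus _ yI yo) m1.
    split; first exact: ltnW.
    apply: connect_trans c1; rewrite -tE //; apply: connect_trans (fconnect1 _ _).
    rewrite ts -{2}(aK y); apply: IH; last by rewrite aI.
    by rewrite mua; exact: leq_trans m2 _.
  have uo : finv pw x != o.
    apply: contraTneq xI => E; rewrite -(f_finv pwI x) E /pw restr_out ?o_notin //.
  have [_ c] := chain _ _ (unfolded_first_return xI) erefl (sno _ uo).
  rewrite ts; apply: connect_trans (fconnect1 _ _) _; rewrite {2}/t aK.
  exact: c.
have xa x : fconnect t x (a x).
  have [xI|xI] := boolP (x \in I); first exact: xax.
  by rewrite ts -{2}(aK x); apply: xax; rewrite aI.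
(* Pass to the outgoing half and follow [s]: [mu] increases and is bounded by [mu i], so the path
   ends at [o]. *)
have xi x : fconnect t x i.
  have [k] := ubnP (mu i - mu x); elim: k x => // k IH x; rewrite ltnS => xk.
  wlog xI : x xk / x \notin I.
    move=> H; have [xI|] := boolP (x \in I); last exact: H.
    by apply: connect_trans (xa x) (H _ _ _); rewrite ?mua // aI xI.
  have [->|xo] := eqVneq x o; first by rewrite -a_o.
  apply: connect_trans (xa x) (connect_trans (fconnect1 _ _) _).
  rewrite tE //; apply: IH; apply: leq_trans xk.
  by apply: ltn_sub2l; [exact: leq_trans (mus _ xI xo) (mui _)|exact: mus].
by move=> x y; apply: connect_trans (xi x) _; rewrite ts.
Qed.

End Unfolding.

(** * Tours of rooted plane trees *)

Section TreeTour.
Variables (X : finType) (tau a : X -> X) (i o : X).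
Hypotheses (tauI : injective tau) (aK : involutive a) (ax : forall x, a x != x).
Hypotheses (ai : a i = o) (tauo : tau o = o).
Let t x := tau (a x).
Hypothesis tC : cyclic_on t.

Definition tidx x := findex t o x.
(** In a tree seen from the leaf [o], this is the half of each edge at the endpoint farther from
    [o], since the tour first crosses the edge away from [o]. *)
Definition downward := [set x | tidx (a x) < tidx x].

Let tI : injective t. Proof. by move=> x y /tauI/(inv_inj aK). Qed.

Let tidx_inj : injective tidx. Proof. exact: cyclic_index_inj tC. Qed.

Lemma tidx_o : tidx o = 0. Proof. exact: findex0. Qed.

Let tidx_step x : t x != o -> tidx (t x) = (tidx x).+1.
Proof. exact: (cyclic_index_step tI tC). Qed.

Lemma downward_swap x : (a x \in downward) = (x \notin downward).
Proof.
rewrite !inE aK -leqNgt ltn_neqAle; case: eqVneq => //= /tidx_inj E.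
by case/eqP: (ax x).
Qed.

Lemma downward_i : i \in downward.
Proof.
rewrite inE ai tidx_o lt0n; apply: contraNneq (ax i) => E.
by rewrite ai; apply/eqP/tidx_inj; rewrite tidx_o E.
Qed.

Lemma downward_o : o \notin downward.
Proof. by rewrite inE tidx_o. Qed.

Lemma cycle_o x : fconnect tau o x -> x = o.
Proof. by move/iter_findex<-; elim: (findex _ _ _) => //= n ->. Qed.

(** Take [v] earliest on the cycle and [u = a (t^-1 v)]: the tour enters the vertex across the edge
    of [u]. As [u] lies on the cycle too, it is not visited before [v], hence after [a u]. *)
Lemma first_visit x : x != o -> exists u,
  [/\ u \in downward, fconnect tau u x & exists v, [/\ v = t (a u), tidx v = (tidx (a u)).+1,
       fconnect tau u v & forall y, fconnect tau u y -> tidx v <= tidx y]].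
Proof.
move=> xo; case: (arg_minnP (P := fconnect tau x) tidx (connect0 _ x)) => v xv vmin.
have vo : v != o.
  apply: contraNneq xo => E; apply/eqP/cycle_o; rewrite fconnect_sym // -E.
  exact: xv.
pose k := finv t v; have kv : t k = v by rewrite /k f_finv.
have akv : fconnect tau (a k) v by rewrite -kv /t; exact: fconnect1.
have xak : fconnect tau x (a k) by apply: connect_trans xv _; rewrite fconnect_sym.
have vk : tidx v = (tidx k).+1 by rewrite -kv tidx_step // kv.
exists (a k); split; first by rewrite inE aK -vk; apply: vmin.
  by rewrite fconnect_sym.
exists v; rewrite aK kv vk; split=> // y ky; rewrite -vk; apply: vmin.
exact: connect_trans xak ky.
Qed.

Definition one_per_cycle (I : {set X}) := {in I &, forall x y, fconnect tau x y -> x = y}.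

(** By [first_visit] every cycle other than that of [o] has a downward half-edge, and the count
    assumed for a tree gives as many such cycles as edges. *)
Lemma downward_unique : ncyc tau (~: [set o]) = #|X|./2 -> one_per_cycle downward.
Proof.
move=> cE; apply: (ncyc_unique (A := ~: [set o])) => //.
- by apply/subsetP => x xD; rewrite !inE; apply: contraTneq xD => ->; apply: downward_o.
- move=> x; rewrite !inE => /first_visit[u [uD ux _]]; exists u => //.
  by rewrite fconnect_sym.
by rewrite cE -(card_swapped aK downward_swap) doubleK.
Qed.

Section Unique.
Hypothesis dU : one_per_cycle downward.

(* Look at the first half-edge of the tour where two orientations of the tree
   away from its root differ. *)
Lemma downward_char (I : {set X}) : (forall x, (a x \in I) = (x \notin I)) ->
  one_per_cycle I -> i \in I -> I = downward.
Proof.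
move=> aI IU iI; suff main k x : tidx x < k -> (x \in I) = (x \in downward).
  by apply/setP=> x; apply: main (ltnSn _).
elim: k x => // k IH x; rewrite ltnS => xk.
have [xD|xD] := boolP (x \in downward).
  have := xD; rewrite inE => /leq_trans/(_ xk)/IH; rewrite downward_swap xD aI.
  by case: (x \in I).
apply/negP => xI.
have xo : x != o by apply: contraTneq xI => ->; rewrite -ai aI iI.
case: (first_visit xo) => u [uD ux [v [_ vu uv vmin]]].
have := vmin _ ux; rewrite vu => /leq_trans/(_ xk)/IH; rewrite downward_swap uD aI.
move=> /negbFE uI; move: xD; rewrite -(IU _ _ uI xI ux) uD //.
Qed.

(** Turning by [tau] leads from any half-edge to the downward one of its vertex, whose opposite half
    is visited earlier. This recursion towards the root supplies [left_ind] for folded trees. *)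
Lemma downward_ind (P : pred X) : P i -> (forall x, P x -> P (a x)) ->
  (forall x, x \notin downward -> P (tau x) -> P x) -> forall x, P x.
Proof.
move=> Pi Pa Ptau x; have [k] := ubnP (tidx x).
elim: k x => // k IH x; rewrite ltnS => xk.
have [->|xo] := eqVneq x o; first by rewrite -ai; apply: Pa.
case: (first_visit xo) => u [uD ux [v [_ vu uv vmin]]].
have Pu : P u.
  by rewrite -(aK u); apply/Pa/IH; apply: leq_trans xk; rewrite -vu; apply: vmin.
have xu : fconnect tau x u by rewrite fconnect_sym.
move/iter_findex: xu; move: (findex _ _ _) => n {xk xo vmin}.
elim: n x ux => [|n IHn] x ux /=; first by move->.
have [xD _|xD] := boolP (x \in downward); first by rewrite -(dU uD xD ux).
rewrite -iterS iterSr => E; apply: Ptau => //; apply: IHn E.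
exact: connect_trans ux (fconnect1 _ _).
Qed.

End Unique.
End TreeTour.

(** * Motion functions and their orientations *)

Section Motion.
Variables (H : finType) (s a : H -> H) (r : H).
Hypotheses (sI : injective s) (aK : involutive a) (ax : forall x, a x != x).
Implicit Types (S : {set H}) (h x : H).

Definition motion S h := if h \in S then s (a h) else s h.
Definition appears S x := findex (motion S) r x.
Definition ingoing S :=
  [set h | if h \in S then appears S (a h) < appears S h
           else appears S h < appears S (a h)].

Section Stable.
Variable S : {set H}.
Hypotheses (aS : forall h, h \in S -> a h \in S).

Lemma stableE h : (a h \in S) = (h \in S).
Proof. by apply/idP/idP => /aS //; rewrite aK. Qed.

Lemma motion_inj : injective (motion S).
Proof.
move=> x y; rewrite /motion; case: ifP => xS; case: ifP => yS /sI //.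
- exact: (inv_inj aK).
- by move=> E; rewrite -E stableE xS in yS.
- by move=> E; rewrite E stableE yS in xS.
Qed.

Hypothesis mC : cyclic_on (motion S).
Notation idx := (appears S).

Lemma appears_inj : injective idx.
Proof. exact: cyclic_index_inj mC. Qed.

Lemma appears_lt x : idx x < #|H|. Proof. exact: cyclic_index_lt. Qed.

Lemma appears_step x : motion S x != r -> idx (motion S x) = (idx x).+1.
Proof. exact: (cyclic_index_step motion_inj mC). Qed.

Lemma ltn_appears x : (idx x < idx (a x)) = ~~ (idx (a x) < idx x).
Proof.
rewrite -leqNgt [RHS]leq_eqVlt; case: eqP => // /appears_inj E.
by case/eqP: (ax x).
Qed.

Lemma in_ingoing x : (x \in ingoing S) = ((x \in S) == (idx (a x) < idx x)).
Proof. by rewrite inE ltn_appears; case: (x \in S); case: (_ < _). Qed.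

(** [in_ingoing] solved for [S]: membership is read off from the orientation and from whether the
    opposite half has already appeared. This is the rule of the walk below. *)
Lemma in_stable x : (x \in S) = ((x \in ingoing S) == (idx (a x) < idx x)).
Proof. by rewrite in_ingoing; case: (x \in S); case: (_ < _). Qed.

Lemma ingoing_swap x : (a x \in ingoing S) = (x \notin ingoing S).
Proof. by rewrite !in_ingoing aK stableE ltn_appears; case: (x \in S); case: (_ < _). Qed.

(** In both cases [s h] is the image under the motion of the later half: an outgoing [h] precedes
    [a h] if it is in [S], and follows it otherwise. *)
Lemma outgoing_step h : h \notin ingoing S -> s h != r ->
  idx (s h) = (maxn (idx h) (idx (a h))).+1.
Proof.
rewrite in_ingoing; have [hS|hS] := boolP (h \in S).
  rewrite -leqNgt => /maxn_idPr->.
  have -> : s h = motion S (a h) by rewrite /motion stableE hS aK.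
  exact: appears_step.
rewrite negb_eqb addFb => /ltnW/maxn_idPl->.
have -> : s h = motion S h by rewrite /motion (negPf hS).
exact: appears_step.
Qed.

(** Let [v] be earliest on the cycle and [k] its predecessor under the motion. Unless [v = r], [k]
    is in [S], since otherwise [k] would be on the cycle and earlier; then [a k] is on the cycle,
    later than [k], hence ingoing. *)
Lemma cycle_meets_ingoing h :
  (exists2 x, x \in ingoing S & fconnect s h x) \/ fconnect s h r.
Proof.
case: (arg_minnP (P := fconnect s h) idx (connect0 _ h)) => v hv vmin.
have [<-|vr] := eqVneq v r; [by right|left].
pose k := finv (motion S) v; have kv : motion S k = v by rewrite f_finv //; exact: motion_inj.
have vk : idx v = (idx k).+1 by rewrite -kv appears_step ?kv.
move: kv; rewrite /motion; case: ifP => [kS kv|_ kv]; last first.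
  have /vmin : fconnect s h k.
    by apply: connect_trans hv _; rewrite fconnect_sym // -kv fconnect1.
  by rewrite vk ltnn.
have hak : fconnect s h (a k).
  by apply: connect_trans hv _; rewrite fconnect_sym // -kv fconnect1.
exists (a k) => //; rewrite in_ingoing stableE kS aK eq_sym eqb_id.
by rewrite -vk; apply: vmin.
Qed.

End Stable.

(** The two motions agree step by step: whether the [k]-th half-edge is selected depends only on the
    orientation and on the half-edges visited before it. *)
Lemma ingoing_determines S1 S2 :
  (forall h, h \in S1 -> a h \in S1) -> (forall h, h \in S2 -> a h \in S2) ->
  cyclic_on (motion S1) -> cyclic_on (motion S2) ->
  ingoing S1 = ingoing S2 -> S1 = S2.
Proof.
move=> st1 st2 c1 c2 E.
pose h1 k := iter k (motion S1) r; pose h2 k := iter k (motion S2) r.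
have same_mem k : k < #|H| -> (forall j, j <= k -> h1 j = h2 j) ->
    (h1 k \in S1) = (h2 k \in S2).
  move=> kH same; rewrite same //; set h := h2 k.
  rewrite (in_stable c1) (in_stable c2) E; congr (_ == _).
  have i1 : appears S1 h = k.
    by rewrite /h -same // /appears cyclic_index_iter //; apply: motion_inj.
  have i2 : appears S2 h = k by rewrite /appears cyclic_index_iter.
  rewrite i1 i2; apply/idP/idP => lt.
    have := cyclic_iter_index r c1 (a h); rewrite -/(h1 _) (same _ (ltnW lt)) => <-.
    by rewrite /appears cyclic_index_iter //; apply: ltn_trans kH.
  have := cyclic_iter_index r c2 (a h); rewrite -/(h2 _) -(same _ (ltnW lt)) => <-.
  by rewrite /appears cyclic_index_iter //; apply: ltn_trans kH.
have same k : k < #|H| -> forall j, j <= k -> h1 j = h2 j.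
  elim: k => [|k IH] kH j; first by rewrite leqn0 => /eqP->.
  have {}IH := IH (ltnW kH).
  rewrite leq_eqVlt ltnS => /orP[/eqP->|/IH //].
  by have := same_mem _ (ltnW kH) IH; rewrite /= /motion -/(h1 k) -/(h2 k) IH // => ->.
apply/setP=> x; rewrite -(cyclic_iter_index r c1 x); set k := findex _ _ _.
have kH : k < #|H| by exact: cyclic_index_lt.
by rewrite -/(h1 k) (same_mem _ kH (same _ kH)) (same _ kH).
Qed.

(** * Reconstruction of a motion function from an orientation *)

Section Walk.
Variable I : {set H}.
Hypothesis aI : forall x, (a x \in I) = (x \notin I).
(* Every half-edge is reached from the root corner by leftmost paths, stated as
   an induction principle. *)
Hypothesis left_ind : forall P : pred H, (forall x, P x -> P (a x)) ->
  (forall x, x \notin I -> P (s x) || (s x == r) -> P x) -> forall x, P x.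

(* Rotor walk recovering the motion function from the orientation; the state
   records the current half-edge and those already left.  From an edge met for
   the first time it proceeds to the [s]-successor of its ingoing half, from an
   edge met again to the successor of its outgoing half. *)
Definition walk_edge (h : H) (V : {set H}) := if (h \in I) == (a h \in V) then a h else h.
Definition walk_step (p : H * {set H}) := (s (walk_edge p.1 p.2), p.1 |: p.2).
Definition walk k := iter k walk_step (r, set0).
Notation w k := (walk k).1.
Notation V k := (walk k).2.
Notation e k := (walk_edge (w k) (V k)).

(** The walk leaves through the ingoing half of an edge while the opposite of the current half-edge
    is unvisited, and through the outgoing half afterwards. *)
Lemma walk_in k : (e k \in I) = (a (w k) \notin V k).
Proof.
by rewrite /walk_edge; case xI: (w k \in I); case: (a (w k) \in V k); rewrite /= ?aI ?xI.
Qed.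

Lemma mem_walk k x : x \in V k <-> exists2 j, j < k & x = w j.
Proof.
elim: k => [|k IH]; first by rewrite inE; split=> // -[].
rewrite /= !inE; split=> [/orP[/eqP->|/IH[j jk ->]]|[j]]; first by exists k.
  by exists j; rewrite // ltnW.
rewrite ltnS leq_eqVlt => /orP[/eqP-> ->|jk xj]; first by rewrite eqxx.
by apply/orP; right; apply/IH; exists j.
Qed.

Lemma walk_repeats : exists k, w k \in V k.
Proof.
case: (pickP (fun k : 'I_#|H|.+1 => w k \in V k)) => [k kV|no]; first by exists k.
have : forall k, k <= #|H|.+1 -> #|V k| = k.
  elim=> [|k IH] kH; first by rewrite cards0.
  rewrite /= cardsU1 (IH (ltnW kH)).
  by have /= -> := no (Ordinal kH).
move/(_ _ (leqnn _)) => E; have := max_card (mem (V #|H|.+1)).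
by rewrite E ltnn.
Qed.

Let N := ex_minn walk_repeats.
Let fresh k : k < N -> w k \notin V k.
Proof. by rewrite /N; case: ex_minnP => m _ mm; apply: contraTN => /mm; rewrite leqNgt. Qed.

Lemma walk_inj j k : j < N -> k < N -> w j = w k -> j = k.
Proof.
have main j' k' : j' < k' -> k' < N -> w j' <> w k'.
  by move=> jk /fresh/negP kV E; apply/kV/mem_walk; exists j'.
move=> jN kN E; case: (ltngtP j k) => // jk; first by case: (main _ _ jk kN).
by case: (main _ _ jk jN).
Qed.

(** If the first repetition were [w j.+1], then [e N.-1 = e j] with [w N.-1 = a (w j)]. At time
    [N.-1] this half-edge must be outgoing, so at time [j] the half [w N.-1] was already visited,
    against freshness. *)
Lemma walk_returns : 0 < N /\ w N = r.
Proof.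
have : w N \in V N by rewrite /N; case: ex_minnP.
move=> /mem_walk[j jN E]; have N0 : 0 < N by apply: leq_trans jN.
split=> //; rewrite E; case: j jN E => // j jN; rewrite -(prednK N0) => /= /sI E.
have PN : N.-1 < N by rewrite prednK.
have jP : j < N.-1 by rewrite -ltnS prednK.
have jN' : j < N by apply: ltn_trans PN.
have ne : w N.-1 != w j.
  by apply/eqP => /(walk_inj PN jN') F; rewrite F ltnn in jP.
have aw : w N.-1 = a (w j).
  move: E; rewrite /walk_edge; case: ifP => _; case: ifP => _ E.
  - by case/eqP: ne; apply: (inv_inj aK).
  - by rewrite -E aK.
  - by rewrite E.
  - by case/eqP: ne.
have : e N.-1 \notin I.
  by rewrite walk_in negbK aw aK; apply/mem_walk; exists j.
rewrite E walk_in negbK -aw => /mem_walk[l lj El].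
by case/negP: (fresh PN); apply/mem_walk; exists l => //; apply: ltn_trans jP.
Qed.

(** Apply [left_ind] to the property that both halves are visited: if [s x] is visited, the walk
    came there by leaving [x], and it leaves an outgoing half only when the whole edge has been
    visited. *)
Lemma walk_covers x : exists2 k, k < N & x = w k.
Proof.
case: walk_returns => N0 wN.
apply/mem_walk; suff : (x \in V N) && (a x \in V N) by case/andP.
apply: (left_ind (P := fun x => (x \in V N) && (a x \in V N))) x => [x|x xI sx].
  by rewrite aK andbC.
(* The starting point [w 0 = r] has no earlier step, but it is also [w N], reached from step
   [N.-1]. *)
have [j jN sj] : exists2 j, j < N & s x = w j.+1.
  have /mem_walk[[|k] kN ->] : s x \in V N.
  - case/orP: sx => [/andP[]//|/eqP->]; apply/mem_walk; by exists 0.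
  - by exists N.-1; rewrite prednK // wN.
  - by exists k => //; apply: ltnW.
have {sj} xj : x = e j by move: sj => /= /sI.
have aj : a (w j) \in V N.
  move: xI; rewrite xj walk_in negbK => /mem_walk[l lj ->]; apply/mem_walk.
  by exists l => //; apply: ltn_trans jN.
have wj : w j \in V N by apply/mem_walk; exists j.
by rewrite xj /walk_edge; case: ifP => _; rewrite ?aK ?aj ?wj.
Qed.

Definition walk_set := [set x | [exists k : 'I_N,
  (w k == x) && ((x \in I) == (a x \in V k))]].

Lemma in_walk_set k : k < N -> (w k \in walk_set) = ((w k \in I) == (a (w k) \in V k)).
Proof.
move=> kN; rewrite inE; apply/existsP/idP => [[j /andP[/eqP E]]|H0].
  by rewrite -(walk_inj (ltn_ord j) kN E) E.
by exists (Ordinal kN); rewrite eqxx.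
Qed.

Lemma walk_motion k : k < N -> motion walk_set (w k) = w k.+1.
Proof. by move=> kN; rewrite /motion in_walk_set //= /walk_edge; case: ifP. Qed.

Lemma iter_motion k : k <= N -> iter k (motion walk_set) r = w k.
Proof. by elim: k => // k IH kN; rewrite iterS IH ?(ltnW kN) // walk_motion. Qed.

Lemma mem_walk_ltn k l : k < N -> l < N -> (w l \in V k) = (l < k).
Proof.
move=> kN lN; apply/idP/idP => [/mem_walk[j jk]|lk]; last by apply/mem_walk; exists l.
by move/(walk_inj lN (ltn_trans jk kN))->.
Qed.

Lemma walk_set_stable h : h \in walk_set -> a h \in walk_set.
Proof.
case: (walk_covers h) (walk_covers (a h)) => k kN -> [l lN E].
rewrite in_walk_set // E in_walk_set // -E aK aI E !mem_walk_ltn //.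
have kl : k != l by apply/eqP => kl; case/eqP: (ax (w k)); rewrite E kl.
by rewrite ltnNge leq_eqVlt eq_sym (negPf kl) /=; case: (_ \in I); case: (_ < _).
Qed.

Lemma walk_cyclic : cyclic_on (motion walk_set).
Proof.
have rx x : fconnect (motion walk_set) r x.
  case: (walk_covers x) => k kN ->; rewrite -iter_motion ?(ltnW kN) //.
  exact: fconnect_iter.
move=> x y; apply: connect_trans (rx y).
by rewrite fconnect_sym //; exact: (motion_inj walk_set_stable).
Qed.

Lemma ingoing_walk : ingoing walk_set = I.
Proof.
have mI := motion_inj walk_set_stable.
(* The walk visits each half-edge exactly once before closing, so step numbers are appearance
   indices. *)
have NH : N = #|H|.
  have : injective (fun k : 'I_N => w k).
    by move=> j k E; apply: val_inj; apply: walk_inj E.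
  move/card_imset => /(_ (mem 'I_N)); rewrite card_ord => <-.
  rewrite -cardsT; congr #|pred_of_set _|; apply/setP=> x; rewrite inE.
  by apply/imsetP; case: (walk_covers x) => k kN ->; exists (Ordinal kN).
have idx k : k < N -> appears walk_set (w k) = k.
  move=> kN; rewrite -iter_motion ?(ltnW kN) //.
  by rewrite /appears cyclic_index_iter -?NH //; apply: walk_cyclic.
apply/setP=> x; rewrite (in_ingoing walk_cyclic).
case: (walk_covers x) (walk_covers (a x)) => k kN -> [l lN E].
rewrite in_walk_set // E !idx // mem_walk_ltn //.
by case: (_ \in I); case: (_ < _).
Qed.

Lemma orientation_realized : exists S, [/\ forall h, h \in S -> a h \in S,
  cyclic_on (motion S) & ingoing S = I].
Proof.
exists walk_set; split; [exact: walk_set_stable|exact: walk_cyclic|exact: ingoing_walk].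
Qed.

End Walk.
End Motion.

(* Duality: [(phi, ~: S)] has the same motion function as [(sigma, S)], hence
   the complementary orientation. *)
Lemma dual_cycle_meets (H : finType) (s a : H -> H) (r : H) (S : {set H}) :
  injective s -> involutive a -> (forall x, a x != x) ->
  (forall h, h \in S -> a h \in S) -> cyclic_on (motion s a S) -> forall h,
  (exists2 x, x \notin ingoing s a r S & fconnect (s \o a) h x) \/ fconnect (s \o a) h r.
Proof.
move=> sI aK ax aS mC h; pose s' := s \o a.
have mE : motion s' a (~: S) =1 motion s a S.
  by move=> x; rewrite /motion inE /s' /= aK; case: (x \in S).
have sI' : injective s' by move=> x y /sI/(inv_inj aK).
have aS' x : x \in ~: S -> a x \in ~: S by rewrite !inE (stableE aK aS).
have mC' : cyclic_on (motion s' a (~: S)).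
  by move=> x y; rewrite (eq_fconnect mE).
have idxE x : appears s' a r (~: S) x = appears s a r S x.
  by apply: (findex_conj (l := id)) => // z; rewrite mE.
have := cycle_meets_ingoing r sI' aK ax aS' mC' h.
case=> [[x xI hx]|]; [left|by right]; exists x => //; move: xI.
by rewrite (in_ingoing r ax mC') (in_ingoing r ax mC) !idxE inE; case: (x \in S); case: (_ < _).
Qed.

(** * Inserting and erasing the root edge *)

Section Extension.
Variable m : nat.
Notation Hi := (Hi m).
Notation Ho := (Ho m).
Notation Hset := (Hset m).
Implicit Types (h : 'I_m) (x c d : 'I_m.+2).

Lemma val_emb h : val (emb h) = val h.
Proof. by rewrite /= inordK // ltnW // ltnW // !ltnS. Qed.

Lemma val_Hi : val Hi = m. Proof. by rewrite /= inordK. Qed.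
Lemma val_Ho : val Ho = m.+1. Proof. by rewrite /= inordK. Qed.

Lemma emb_inj : injective (@emb m).
Proof. by move=> x y /(congr1 val); rewrite !val_emb => /val_inj. Qed.

Lemma emb_Hset h : emb h \in Hset.
Proof. by rewrite inE val_emb ltn_ord. Qed.

Lemma Hi_Hset : Hi \notin Hset.
Proof. by rewrite inE val_Hi ltnn. Qed.

Lemma Ho_Hset : Ho \notin Hset.
Proof. by rewrite inE val_Ho -leqNgt ltnW. Qed.

Lemma dec_emb h : dec (emb h) = Some h.
Proof. by rewrite /dec val_emb valK. Qed.

Lemma dec_Hi : dec Hi = None.
Proof. by rewrite /dec insubF // val_Hi ltnn. Qed.

Lemma dec_Ho : dec Ho = None.
Proof. by rewrite /dec insubF // val_Ho ltnNge leqnSn. Qed.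

Lemma Hio : Hi != Ho.
Proof. by apply/eqP => /(congr1 val)/eqP; rewrite val_Hi val_Ho -addn1 -{1}[m]addn0 eqn_add2l. Qed.

Lemma emb_neq c h : dec c = None -> (emb h == c) = false.
Proof. by move=> cN; apply/eqP => E; move: cN; rewrite -E dec_emb. Qed.

Variant half_edge_spec : 'I_m.+2 -> Prop :=
| HalfEmb h : half_edge_spec (emb h)
| HalfHi : half_edge_spec Hi
| HalfHo : half_edge_spec Ho.

Lemma half_edgeP x : half_edge_spec x.
Proof.
have [xm|] := ltnP x m.
  have -> : x = emb (Ordinal xm) by apply: val_inj; rewrite val_emb.
  exact: HalfEmb.
rewrite leq_eqVlt => /orP[/eqP mx|].
  have -> : x = Hi; [by apply: val_inj; rewrite val_Hi|exact: HalfHi].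
move=> mx; have -> : x = Ho; last exact: HalfHo.
by apply: val_inj; rewrite val_Ho; apply/eqP; rewrite eqn_leq mx -ltnS ltn_ord.
Qed.

Lemma dec_some x h : dec x = Some h -> x = emb h.
Proof. by case: (half_edgeP x) => [k| |]; rewrite ?dec_emb ?dec_Hi ?dec_Ho // => -[->]. Qed.

(* Common form of [sigp] (with [c = i]), of [phip] (with [c = o]), and of [taup]
   as a function of the tree. *)
Definition ext (f : 'I_m -> 'I_m) (ro : option 'I_m) c x : 'I_m.+2 :=
  match dec x with
  | Some h => if Some (f h) == ro then c else emb (f h)
  | None => if x == c then (if ro is Some r then emb r else c) else x
  end.

Definition erase (F : 'I_m.+2 -> 'I_m.+2) h : 'I_m :=
  odflt h (dec (restr F Hset (emb h))).

Section Ext.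
Variables (f : 'I_m -> 'I_m) (ro : option 'I_m) (c : 'I_m.+2).
Hypotheses (fI : injective f) (cN : dec c = None).
Notation F := (ext f ro c).

Lemma ext_emb h : F (emb h) = if Some (f h) == ro then c else emb (f h).
Proof. by rewrite /ext dec_emb. Qed.

Lemma ext_c : F c = if ro is Some r then emb r else c.
Proof. by rewrite /ext cN eqxx. Qed.

Lemma ext_other d : dec d = None -> d != c -> F d = d.
Proof. by rewrite /ext => -> /negPf->. Qed.

Lemma cNHset : c \notin Hset.
Proof. by apply/negP; rewrite inE => cm; move: cN; rewrite /dec insubT. Qed.

Lemma ext_inj : injective F.
Proof.
have NNc d h : dec d = None -> d != c -> F (emb h) != d.
  move=> dN dc; rewrite ext_emb; case: ifP => _; first by rewrite eq_sym.
  by rewrite emb_neq.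
have FcNN d : dec d = None -> d != c -> F c != d.
  move=> dN dc; rewrite ext_c; case: ro => [r|]; last by rewrite eq_sym.
  by rewrite emb_neq.
have Fec h : F (emb h) != F c.
  rewrite ext_emb ext_c; case: ro => [r|]; last by rewrite emb_neq.
  case: (Some (f h) =P Some r) => [_|ne]; first by rewrite eq_sym emb_neq.
  by apply/eqP => /emb_inj E; case: ne; rewrite E.
have cls x : (exists h, x = emb h) \/ dec x = None.
  by case: (half_edgeP x) => [h| |]; [left; exists h|right; exact: dec_Hi|right; exact: dec_Ho].
move=> x y; case: (cls x) (cls y) => [[h ->]|xN] [[k ->]|yN].
- rewrite !ext_emb; case: eqP => [<-|hr]; case: eqP => [|kr].
  + by move=> [/fI->].
  + by move/eqP; rewrite eq_sym emb_neq.
  + by move=> _ /eqP; rewrite emb_neq.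
  + by move=> /emb_inj/fI->.
- have [->|yc] := eqVneq y c; first by move/eqP; rewrite (negPf (Fec _)).
  by move/eqP; rewrite (ext_other yN yc) (negPf (NNc _ _ yN yc)).
- have [->|xc] := eqVneq x c; first by move/eqP; rewrite eq_sym (negPf (Fec _)).
  by move/eqP; rewrite (ext_other xN xc) eq_sym (negPf (NNc _ _ xN xc)).
- have [->|xc] := eqVneq x c; have [->|yc] := eqVneq y c => //.
  + by rewrite (ext_other yN yc) => /eqP; rewrite (negPf (FcNN _ yN yc)).
  + by rewrite (ext_other xN xc) => /eqP; rewrite eq_sym (negPf (FcNN _ xN xc)).
  + by rewrite !ext_other.
Qed.

Lemma restr_ext h : restr F Hset (emb h) = emb (f h).
Proof.
apply: restr_eq; [exact: ext_inj|exact: emb_Hset|].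
rewrite ext_emb; case: eqP => [fr|_]; last by apply: hit_here; apply: emb_Hset.
apply: hit_next; first exact: cNHset.
by rewrite ext_c -fr; apply: hit_here; apply: emb_Hset.
Qed.

Lemma fconnect_ext h k : fconnect F (emb h) (emb k) = fconnect f h k.
Proof.
rewrite -(restr_connect (S := Hset)) ?emb_Hset //; last exact: ext_inj.
by apply: fconnect_conj; [exact: emb_inj|move=> z; rewrite restr_ext].
Qed.

Hypothesis roE : isSome ro = (0 < m).

(** Inserting [c] only lengthens the cycle of the root. If [m = 0], the cycle of [c] alone accounts
    for the conventional value 1. *)
Lemma ncyc_ext d : dec d = None -> d != c -> (forall x, dec x = None -> x = c \/ x = d) ->
  ncyc F (~: [set d]) = if m == 0 then 1 else ncyc f setT.
Proof.
move=> dN dc cd; case: (posnP m) => [m0|mP].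
  rewrite ?m0 ?eqxx /=; apply: ncyc_cyclic; first exact: ext_inj.
    have E x : x \in ~: [set d] -> x = c.
      rewrite !inE; case xE: (dec x) => [h|].
        by case: h {xE} => k kl; exfalso; rewrite m0 in kl.
      by case: (cd _ xE) => -> //; rewrite eqxx.
    by move=> x y /E-> /E->; apply: connect0.
  by apply/set0Pn; exists c; rewrite !inE eq_sym.
apply: (ncyc_conj (l := @emb m)) => //.
- exact: ext_inj.
- by move=> x y _ _; apply: fconnect_ext.
- by move=> x _; rewrite !inE emb_neq.
move=> x; rewrite !inE => xd; case xE: (dec x) => [h|].
  by exists h; rewrite ?inE // (dec_some xE) connect0.
case: (cd _ xE) => xc; last by rewrite xc eqxx in xd.
move: roE; rewrite mP; case roR: ro => [r|] // _.
by exists r; rewrite ?inE //; rewrite xc; apply: connect1; rewrite /= /ext cN eqxx.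
Qed.

End Ext.

Lemma ncyc_ext_Hi f ro : injective f -> isSome ro = (0 < m) ->
  ncyc (ext f ro Hi) (~: [set Ho]) = if m == 0 then 1 else ncyc f setT.
Proof.
move=> fI roE; apply: ncyc_ext; rewrite ?dec_Hi ?dec_Ho //; first by rewrite eq_sym Hio.
by move=> x; case: (half_edgeP x) => [h| |]; rewrite ?dec_emb //; [left|right].
Qed.

Lemma ncyc_ext_Ho f ro : injective f -> isSome ro = (0 < m) ->
  ncyc (ext f ro Ho) (~: [set Hi]) = if m == 0 then 1 else ncyc f setT.
Proof.
move=> fI roE; apply: ncyc_ext; rewrite ?dec_Hi ?dec_Ho ?Hio //.
by move=> x; case: (half_edgeP x) => [h| |]; rewrite ?dec_emb //; [right|left].
Qed.

Section Erase.
Variable F : 'I_m.+2 -> 'I_m.+2.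
Hypotheses (FI : injective F).

Lemma emb_erase h : emb (erase F h) = restr F Hset (emb h).
Proof.
rewrite /erase; have := restr_in FI (emb_Hset h); case: (half_edgeP (restr _ _ _)) => [k| |].
- by rewrite dec_emb.
- by rewrite (negPf Hi_Hset).
- by rewrite (negPf Ho_Hset).
Qed.

Lemma erase_inj : injective (erase F).
Proof. by move=> x y /(congr1 (@emb m)); rewrite !emb_erase => /(restr_inj FI)/emb_inj. Qed.

Hypotheses (Fo : F Ho = Ho) (Fi : 0 < m -> F Hi != Hi).

Lemma dec_root : isSome (dec (F Hi)) = (0 < m).
Proof.
case: (posnP m) => [m0|mP].
  by case: (dec _) => // -[k kl]; exfalso; rewrite m0 in kl.
have := Fi mP; case E: (F Hi) / (half_edgeP (F Hi)) => [h| |]; rewrite ?dec_emb ?eqxx // => _.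
by move: Hio; rewrite -(FI (etrans E (esym Fo))) eqxx.
Qed.

(** Converse of [restr_ext]: such an [F] is the insertion of [Hi] just before [F Hi], which becomes
    the root. *)
Lemma ext_erase : F =1 ext (erase F) (dec (F Hi)) Hi.
Proof.
move=> x; case: (half_edgeP x) => [h| |]; last first.
- by rewrite ext_other ?dec_Ho // eq_sym Hio.
- rewrite ext_c ?dec_Hi //; case E: (F Hi) / (half_edgeP (F Hi)) => [k| |];
    rewrite ?dec_emb ?dec_Hi //.
  by move: Hio; rewrite (FI (etrans E (esym Fo))) eqxx.
rewrite ext_emb; case E: (F (emb h)) / (half_edgeP (F (emb h))) => [k| |].
- have -> : erase F h = k.
    apply: emb_inj; rewrite emb_erase; apply: restr_eq => //; first exact: emb_Hset.
    by rewrite E; apply: hit_here; apply: emb_Hset.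
  case: eqP => // /esym/dec_some; rewrite -E => /FI/eqP.
  by rewrite eq_sym emb_neq ?dec_Hi.
- suff -> : dec (F Hi) = Some (erase F h) by rewrite eqxx.
  have mP : 0 < m by apply: leq_ltn_trans (ltn_ord h).
  have := dec_root; rewrite mP; case rE: (dec _) => [r|] // _; congr Some.
  apply: emb_inj; rewrite emb_erase; symmetry; apply: restr_eq => //; first exact: emb_Hset.
  rewrite E; apply: hit_next; first exact: Hi_Hset.
  by rewrite (dec_some rE); apply: hit_here; apply: emb_Hset.
- by move/eqP: (FI (etrans E (esym Fo))); rewrite emb_neq ?dec_Ho.
Qed.

End Erase.

(** * Relabelling the original half-edges while fixing the root edge *)

Section Lift.
Variable l : {perm 'I_m}.

Definition lift_half x := if dec x is Some h then emb (l h) else x.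

Lemma lift_emb h : lift_half (emb h) = emb (l h).
Proof. by rewrite /lift_half dec_emb. Qed.

Lemma lift_none c : dec c = None -> lift_half c = c.
Proof. by rewrite /lift_half => ->. Qed.

Lemma lift_half_inj : injective lift_half.
Proof.
move=> x y; rewrite /lift_half; case xE: (dec x) => [h|]; case yE: (dec y) => [k|] //.
- by move/emb_inj/perm_inj => hk; rewrite (dec_some xE) (dec_some yE) hk.
- by move=> E; move: yE; rewrite -E dec_emb.
- by move=> E; move: xE; rewrite E dec_emb.
Qed.

Lemma lift_Hset x : (lift_half x \in Hset) = (x \in Hset).
Proof.
case: (half_edgeP x) => [h| |]; rewrite ?lift_emb ?emb_Hset // lift_none //.
  exact: dec_Hi.
exact: dec_Ho.
Qed.

Variables (f g : 'I_m -> 'I_m) (ro ro' : option 'I_m) (c : 'I_m.+2).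
Hypotheses (fI : injective f) (gI : injective g) (cN : dec c = None).

Lemma lift_ext : (forall h, l (f h) = g (l h)) -> omap l ro = ro' ->
  forall x, lift_half (ext f ro c x) = ext g ro' c (lift_half x).
Proof.
move=> fg <- x; rewrite {2}/lift_half; case xE: (dec x) => [h|].
  rewrite {1}/ext xE ext_emb -fg -[Some (l _)]/(omap l (Some _)).
  rewrite (inj_eq (inj_omap (@perm_inj _ l))).
  by case: ifP => _; rewrite ?lift_emb ?lift_none.
rewrite /ext xE; case: ifP => _; last by rewrite lift_none.
by case: ro => [r|] /=; rewrite ?lift_emb ?lift_none.
Qed.

(** Erasing [c] recovers [f] and [g], and the image of [c] recovers the roots. *)
Lemma unlift_ext : (forall x, lift_half (ext f ro c x) = ext g ro' c (lift_half x)) ->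
  (forall h, l (f h) = g (l h)) /\ omap l ro = ro'.
Proof.
move=> FG; split=> [h|].
  apply: emb_inj; rewrite -lift_emb -(restr_ext ro fI cN).
  rewrite (restr_conj (ext_inj fI cN) (ext_inj gI cN) FG lift_Hset).
  by rewrite lift_emb restr_ext.
have := FG c; rewrite (lift_none cN) !ext_c //.
case: ro ro' => [r|] [r'|] //=.
- by rewrite lift_emb => /emb_inj->.
- by rewrite lift_emb => /eqP; rewrite emb_neq.
- by rewrite lift_none // => /eqP; rewrite eq_sym emb_neq.
Qed.

End Lift.
End Extension.

(** * Unfolded maps *)

Definition half_edge_system m (M : rmap m) : Prop :=
  [/\ injective (sigm M), involutive (alpm M), forall h, alpm M h != h
    & isSome (mroot M) = (0 < m)].

Lemma is_map_system m (M : rmap m) : is_map M -> half_edge_system M.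
Proof. by case. Qed.

Lemma map_ind m (M : rmap m) x0 (P : pred 'I_m) : is_map M -> P x0 ->
  (forall x, P x -> P (sigm M x)) ->
  (forall x, P x -> P (alpm M x)) -> forall x, P x.
Proof.
move=> hM P0 Ps Pa x; case: hM => _ _ _ /(_ x0 x)/connectP[p pp ->] _.
elim: p x0 P0 pp => //= y p IH z Pz /andP[/orP[] /eqP-> pp]; apply: IH pp; auto.
Qed.

Lemma coloring_unique m (M : rmap m) r col1 col2 : is_map M ->
  proper_coloring M col1 ->
  proper_coloring M col2 -> col1 r = col2 r -> col1 =1 col2.
Proof.
move=> hM [s1 a1] [s2 a2] E x; apply/eqP.
apply: (map_ind (x0 := r) (P := fun x => col1 x == col2 x) hM) x => [|x|x].
- by rewrite E.
- by rewrite s1 s2.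
have ne b c : b != c -> b = ~~ c by case: b; case: c.
by rewrite (ne _ _ (a1 x)) (ne _ _ (a2 x)) => /eqP->.
Qed.

Lemma is_map_cyclic m (M : rmap m) : half_edge_system M -> cyclic_on (phim M) -> is_map M.
Proof.
move=> [sI aK ax rE] pC; split=> // x y; have /iter_findex<- := pC x y.
elim: (findex _ _ _) => [|k IH] /=; first exact: connect0.
apply: connect_trans IH (connect_trans (connect1 _) (connect1 _)).
  by apply/orP; right; apply: eqxx.
by apply/orP; left; apply: eqxx.
Qed.

Section Maps.
Variables (m : nat) (M : rmap m).
Notation Hi := (Hi m).
Notation Ho := (Ho m).

Hypothesis hM : half_edge_system M.
Let sI : injective (sigm M). Proof. by case: hM. Qed.
Let aK : involutive (alpm M). Proof. by case: hM. Qed.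
Let ax h : alpm M h != h. Proof. by case: hM. Qed.
Let rE : isSome (mroot M) = (0 < m). Proof. by case: hM. Qed.

Lemma phim_inj : injective (phim M).
Proof. by move=> x y /sI/(inv_inj aK). Qed.

Lemma root_some (h : 'I_m) : exists r, mroot M = Some r.
Proof.
have mP : 0 < m by apply: leq_ltn_trans (ltn_ord h).
by move: rE; rewrite mP; case: (mroot M) => // r; exists r.
Qed.

Lemma nfaces_cyclic : nfaces M = 1 <-> cyclic_on (phim M).
Proof.
rewrite /nfaces; case: (posnP m) => [m0|mP].
  by split=> // _ [k kl]; exfalso; rewrite m0 in kl.
split=> [|pC]; first exact: (ncyc1_cyclic phim_inj).
apply: (ncyc_cyclic phim_inj) => //; apply/set0Pn.
by exists (Ordinal mP).
Qed.

Lemma alpp_emb h : alpp M (emb h) = emb (alpm M h).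
Proof. by rewrite /alpp dec_emb. Qed.

Lemma alpp_Hi : alpp M Hi = Ho.
Proof. by rewrite /alpp dec_Hi eqxx. Qed.

Lemma alpp_Ho : alpp M Ho = Hi.
Proof. by rewrite /alpp dec_Ho eq_sym (negPf (Hio m)). Qed.

Lemma alppK : involutive (alpp M).
Proof.
move=> x; case: (half_edgeP x) => [h| |]; rewrite ?alpp_emb ?aK //.
  by rewrite alpp_Hi alpp_Ho.
by rewrite alpp_Ho alpp_Hi.
Qed.

Lemma alpp_neq x : alpp M x != x.
Proof.
case: (half_edgeP x) => [h| |].
- by rewrite alpp_emb (inj_eq (@emb_inj m)).
- by rewrite alpp_Hi eq_sym Hio.
- by rewrite alpp_Ho Hio.
Qed.

Lemma sigp_ext : sigp M = ext (sigm M) (mroot M) Hi. Proof. by []. Qed.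
Lemma phip_ext : phip M = ext (phim M) (mroot M) Ho. Proof. by []. Qed.

Lemma sigp_inj : injective (sigp M).
Proof. by rewrite sigp_ext; apply: ext_inj => //; apply: dec_Hi. Qed.

Lemma phip_inj : injective (phip M).
Proof. by rewrite phip_ext; apply: ext_inj; [apply: phim_inj|apply: dec_Ho]. Qed.

Lemma ext_Ho f ro : ext f ro Hi Ho = Ho.
Proof. by rewrite ext_other ?dec_Ho // eq_sym Hio. Qed.

Lemma ext_Hi f ro : ext f ro Ho Hi = Hi.
Proof. by rewrite ext_other ?dec_Hi // Hio. Qed.

Lemma sigp_Ho : sigp M Ho = Ho. Proof. exact: ext_Ho. Qed.

(** [sigp] composed with [alpp] puts both [Hi] and [Ho] before the root in its face, whereas [phip]
    puts only [Ho] there and fixes [Hi]. *)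
Lemma phipE x : phip M x = tperm Hi Ho (sigp M (alpp M x)).
Proof.
rewrite phip_ext sigp_ext; case: (half_edgeP x) => [h| |].
- rewrite alpp_emb !ext_emb -/(phim M h); case: ifP => _; first by rewrite tpermL.
  by rewrite tpermD // eq_sym emb_neq ?dec_Hi ?dec_Ho.
- by rewrite alpp_Hi ext_Ho ext_Hi tpermR.
rewrite alpp_Ho !ext_c ?dec_Hi ?dec_Ho //; case: (mroot M) => [r|]; last by rewrite tpermL.
by rewrite tpermD // eq_sym emb_neq ?dec_Hi ?dec_Ho.
Qed.

(* Tour of the tree [M] with the edge (i, o) attached as a leaf at the root corner. *)
Definition ext_tour x := ext (sigm M) (mroot M) Hi (alpp M x).

Lemma ext_tour_inj : injective ext_tour.
Proof. by move=> x y /sigp_inj/(inv_inj alppK). Qed.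

(** The extended tour differs from the face only by the detour through [Hi] and [Ho] before the
    root. *)
Lemma restr_ext_tour h : restr ext_tour (Hset m) (emb h) = emb (phim M h).
Proof.
apply: restr_eq; [exact: ext_tour_inj|exact: emb_Hset|].
rewrite {2}/ext_tour alpp_emb ext_emb; case: eqP => [pr|_]; last first.
  by apply: hit_here; apply: emb_Hset.
apply: hit_next; first exact: Hi_Hset.
rewrite /ext_tour alpp_Hi ext_Ho; apply: hit_next; first exact: Ho_Hset.
by rewrite alpp_Ho ext_c ?dec_Hi // -pr; apply: hit_here; apply: emb_Hset.
Qed.

Lemma ext_tour_cyclic : cyclic_on ext_tour <-> cyclic_on (phim M).
Proof.
have tE h k : fconnect ext_tour (emb h) (emb k) = fconnect (phim M) h k.
  rewrite -(restr_connect ext_tour_inj (emb_Hset h) (emb_Hset k)).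
  by apply: fconnect_conj; [exact: emb_inj|move=> z; rewrite restr_ext_tour].
split=> [tC h k|pC]; first by rewrite -tE.
have tS := fconnect_sym ext_tour_inj.
have tio : fconnect ext_tour Hi Ho.
  by apply: connect1; rewrite /= /ext_tour alpp_Hi ext_Ho eqxx.
have to h : fconnect ext_tour (emb h) Ho.
  have [r rr] := root_some h.
  rewrite tS; apply: (connect_trans (y := emb r)); last by rewrite tE.
  by apply: connect1; rewrite /= /ext_tour alpp_Ho ext_c ?dec_Hi // rr.
have all x : fconnect ext_tour x Ho by case: (half_edgeP x).
by move=> x y; apply: connect_trans (all x) _; rewrite tS.
Qed.

Lemma Ip_emb (I : {set 'I_m}) h : (emb h \in Ip I) = (h \in I).
Proof.
rewrite !inE emb_neq ?dec_Hi // orbF; apply/imsetP/idP => [[k kI /emb_inj->]//|hI].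
by exists h.
Qed.

Lemma Ip_Hi (I : {set 'I_m}) : Hi \in Ip I.
Proof. by rewrite !inE eqxx orbT. Qed.

Lemma Ip_Ho (I : {set 'I_m}) : Ho \notin Ip I.
Proof.
rewrite !inE [_ == Hi]eq_sym (negPf (Hio m)) orbF; apply/imsetP => -[h _ /eqP].
by rewrite eq_sym emb_neq ?dec_Ho.
Qed.

Section Orientation.
Variable I : {set 'I_m}.
Hypothesis aI : forall h, (alpm M h \in I) = (h \notin I).

Lemma Ip_swap x : (alpp M x \in Ip I) = (x \notin Ip I).
Proof.
case: (half_edgeP x) => [h| |]; first by rewrite alpp_emb !Ip_emb aI.
  by rewrite alpp_Hi Ip_Hi (negPf (Ip_Ho I)).
by rewrite alpp_Ho Ip_Hi Ip_Ho.
Qed.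

Lemma card_Ip : #|Ip I| = m./2.+1.
Proof.
have := card_swapped alppK Ip_swap; rewrite card_ord => E.
by rewrite -[LHS]doubleK E.
Qed.

Lemma taup_inj : injective (taup M I).
Proof. exact: (unfolded_inj sigp_inj (I := Ip I)). Qed.

Lemma taup_out x : x \notin Ip I -> taup M I x = sigp M x.
Proof. exact: (unfolded_out sigp_inj). Qed.

Lemma taup_Ho : taup M I Ho = Ho.
Proof. by rewrite taup_out ?Ip_Ho // sigp_Ho. Qed.

Lemma piL_white x : x \in Ip I -> piL M I x = pic M I x.
Proof. exact: (pi_white (sigp M) phip_inj). Qed.

Lemma piL_color x : (piL M I x \in Ip I) = (x \in Ip I).
Proof. exact: (pi_color sigp_inj alppK phip_inj Ip_swap). Qed.

Lemma taup_pic x : taup M I (pic M I x) = sigp M x.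
Proof. exact: (unfolded_restr (Ip I) sigp_inj). Qed.

Lemma piL_tour x : x \in Ip I ->
  restr (fun y => taup M I (alpp M y)) (~: Ip I)
    (alpp M (piL M I (alpp M (piL M I (alpp M x))))) = alpp M x.
Proof.
exact: (tour_face sigp_inj alppK phip_inj Ip_swap alpp_Hi (Ip_Hi I) sigp_Ho phipE).
Qed.

Lemma taup_alpp_inj : injective (fun y => taup M I (alpp M y)).
Proof. by move=> x y /taup_inj/(inv_inj alppK). Qed.

Section Connected.
Hypothesis tC : cyclic_on (fun x => taup M I (alpp M x)).

(** Otherwise [Hi] and [Ho] alone would be closed under the cyclic tour. *)
Lemma taup_Hi : 0 < m -> taup M I Hi != Hi.
Proof.
move=> mP; apply/eqP => E; have /iter_findex := tC Hi (emb (Ordinal mP)).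
set k := findex _ _ _; set f := fun x => _.
have : iter k f Hi = Hi \/ iter k f Hi = Ho.
  elim: k => [|k [] /= ->]; first by left.
    by right; rewrite /f alpp_Hi taup_Ho.
  by left; rewrite /f alpp_Ho E.
by case=> -> /eqP; rewrite eq_sym emb_neq ?dec_Hi ?dec_Ho.
Qed.

Lemma taup_ext : taup M I =1 ext (tauL M I) (mroot (Lambda1 M I)) Hi.
Proof. exact: (ext_erase taup_inj taup_Ho taup_Hi). Qed.

Lemma tauL_inj : injective (tauL M I).
Proof. exact: (erase_inj taup_inj). Qed.

Lemma Lambda1_root : isSome (mroot (Lambda1 M I)) = (0 < m).
Proof. exact: (dec_root taup_inj taup_Ho taup_Hi). Qed.

Lemma beta_cyclic : cyclic_on (fun x => piL M I (alpp M x)).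
Proof.
exact: (face_cyclic sigp_inj alppK phip_inj Ip_swap alpp_Hi (Ip_Hi I) sigp_Ho phipE tC).
Qed.

Lemma piL_inj : injective (piL M I).
Proof. exact: (pi_inj sigp_inj phip_inj). Qed.

Lemma Lambda2_system : half_edge_system (Lambda2 M I).
Proof. by split=> //; [exact: piL_inj|exact: alppK|exact: alpp_neq]. Qed.

Lemma Lambda2_map : is_map (Lambda2 M I).
Proof. exact: is_map_cyclic Lambda2_system beta_cyclic. Qed.

Lemma Lambda1_system : half_edge_system (Lambda1 M I).
Proof. by split=> //; [exact: tauL_inj|exact: Lambda1_root]. Qed.

Lemma Ip_coloring : proper_coloring (Lambda2 M I) (fun x => x \in Ip I).
Proof.
split=> x /=; last by rewrite Ip_swap; case: (x \in _).
exact: piL_color.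
Qed.

End Connected.
End Orientation.
End Maps.

(** * Covered maps *)

Section Covered.
Variables (m : nat) (M : rmap m) (S : {set 'I_m}).
Notation Hi := (Hi m).
Notation Ho := (Ho m).
Hypotheses (hM : is_map M) (aS : alpha_stable M S).
Let sI : injective (sigm M). Proof. by case: hM. Qed.
Let aK : involutive (alpm M). Proof. by case: hM. Qed.
Let ax h : alpm M h != h. Proof. by case: hM. Qed.
Let sys := is_map_system hM.
Let thI : injective (theta M S) := motion_inj sI aK aS.

Lemma restr_theta : {in S, restr (theta M S) S =1
  fun h => restr (sigm M) S (restr (alpm M) S h)}.
Proof.
move=> h hS; have ahS := aS hS.
rewrite (restr_step hS ahS); symmetry; apply: restr_eq => //.
have := restr_hit thI hS; have -> : theta M S h = sigm M (alpm M h) by rewrite /theta hS.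
by apply: hit_eq_off => x xS; rewrite /theta (negPf xS).
Qed.

Lemma fconnect_theta x y : x \in S -> y \in S ->
  fconnect (fun h => restr (sigm M) S (restr (alpm M) S h)) x y =
  fconnect (theta M S) x y.
Proof.
move=> xS yS; rewrite -(restr_connect thI xS yS); symmetry.
apply: (eq_in_fconnect (S := S)) => // z zS; first exact: restr_theta.
exact: restr_in.
Qed.

Lemma sigm_theta : S = set0 -> theta M S =1 sigm M.
Proof. by move=> S0 x; rewrite /theta S0 inE. Qed.

(** Restricted to [S], [theta] is the face permutation of the submap; outside [S] it follows
    [sigm M], so that reaching [S] expresses that the submap is connecting. For [S] empty, [theta]
    is [sigm M] itself. *)
Lemma covered_theta : is_covered M S <-> cyclic_on (theta M S).
Proof.
have thS := fconnect_sym thI; split.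
  case=> _ _ _ cov uni x y.
  have reach h : (exists2 z, z \in S & fconnect (theta M S) h z) \/
                 (S = set0 /\ nverts M = 1).
    case: cov => [/(_ h)[z zS /hit_exists/(_ zS)[w hw]]|]; [left|by right].
    exists w; first exact: hit_in hw.
    apply: (hit_connect (S := S)); apply: hit_eq_off hw => u uS.
    by rewrite /theta (negPf uS).
  case: (reach x) (reach y) => [[u uS xu]|[S0 v1]].
    case=> [[v vS yv]|[S0 _]]; last by rewrite S0 inE in uS.
    apply: connect_trans xu _; rewrite thS; apply: connect_trans yv _.
    by rewrite -fconnect_theta //; apply: uni.
  move=> _; rewrite (eq_fconnect (sigm_theta S0)).
  move: v1; rewrite /nverts; case: eqP => [m0 _|_].
    by case: x => k kl; exfalso; rewrite m0 in kl.
  by move/(ncyc1_cyclic sI).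
move=> tC; split=> //.
- move=> x y xS yS; have := tC x y; rewrite -fconnect_theta // => /iter_findex<-.
  elim: (findex _ _ _) => [|k IH]; first exact: connect0.
  apply: connect_trans IH (connect_trans (connect1 _) (connect1 _)).
    by apply/orP; right; apply: eqxx.
  by rewrite iterS; apply/orP; left; apply: eqxx.
- have [S0|/set0Pn[z zS]] := eqVneq S set0.
    right; split=> //; rewrite /nverts; case: eqP => // m0.
    apply: ncyc_cyclic => //; last first.
      apply/set0Pn; case: (posnP m) => // mP; by exists (Ordinal mP).
    by move=> x y _ _; rewrite -(eq_fconnect (sigm_theta S0)).
  left=> h; have /hit_exists/(_ zS)[w hw] := tC h z; exists w; first exact: hit_in hw.
  apply: (hit_connect (S := S)); apply: hit_eq_off hw => u uS.
  by rewrite /theta (negPf uS).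
by move=> x y xS yS; rewrite fconnect_theta.
Qed.

Hypothesis tC : cyclic_on (theta M S).
Notation I := (Delta M S).

Lemma DeltaE r : mroot M = Some r -> I = ingoing (sigm M) (alpm M) r S.
Proof. by rewrite /Delta => ->. Qed.

Lemma Delta_swap h : (alpm M h \in I) = (h \notin I).
Proof. by have [r /DeltaE->] := root_some sys h; exact: ingoing_swap. Qed.

Lemma Delta_tour_cyclic : cyclic_on (fun x => taup M I (alpp M x)).
Proof.
(* [mu] is the appearance index of the later half of an edge, which [outgoing_step] makes increase.
   The root edge gets [m], above all indices, because [Hi] is inserted where the order wraps
   around. *)
pose mu' h := if mroot M is Some r then
  maxn (appears (sigm M) (alpm M) r S h) (appears (sigm M) (alpm M) r S (alpm M h)) else 0.
pose mu x := if dec x is Some h then mu' h else m.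
have muE h : mu (emb h) = mu' h by rewrite /mu dec_emb.
have mui : mu Hi = m by rewrite /mu dec_Hi.
have muo : mu Ho = m by rewrite /mu dec_Ho.
have mu_lt h : mu' h < m.
  rewrite /mu'; case: (root_some sys h) => r ->; rewrite gtn_max.
  by have := @appears_lt _ (sigm M) (alpm M) r S tC; rewrite card_ord => H; rewrite !H.
refine (tour_cyclic (sigp_inj sys) (alppK sys) (Ip_swap Delta_swap)
  (alpp_Hi M) (Ip_Hi I) (sigp_Ho M) (mu := mu) _ _ _).
- move=> x; case: (half_edgeP x) => [h| |]; last by rewrite alpp_Ho mui.
    by rewrite alpp_emb !muE /mu' aK; case: (mroot M) => // r; rewrite maxnC.
  by rewrite alpp_Hi muo.
- move=> x; case: (half_edgeP x) => [h| |]; rewrite ?Ip_Hi ?eqxx //.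
  rewrite Ip_emb muE sigp_ext ext_emb => hI _.
  case: eqP => [_|ne]; first by rewrite mui.
  case: (root_some sys h) => r rr; rewrite muE {2}/mu' rr.
  rewrite (DeltaE rr) in hI; rewrite leq_max (outgoing_step sI aK ax aS tC hI).
    by rewrite /mu' rr leqnn.
  by apply/eqP => E; apply: ne; rewrite E rr.
move=> x; rewrite mui; case: (half_edgeP x) => [h| |]; rewrite ?mui ?muo // muE.
exact: ltnW.
Qed.

(** A vertex without ingoing half-edge contains the root, hence contains [Hi] after the
    insertion. *)
Lemma sigp_meets x : x != Ho -> exists2 y, y \in Ip I & fconnect (sigp M) x y.
Proof.
have dHi := dec_Hi m.
case: (half_edgeP x) => [h _| |]; last by rewrite eqxx.
  have [r rr] := root_some sys h.
  case: (cycle_meets_ingoing r sI aK ax aS tC h) => [[y yI hy]|hr].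
    by exists (emb y); rewrite ?Ip_emb ?(DeltaE rr) // sigp_ext fconnect_ext.
  exists Hi; rewrite ?Ip_Hi // fconnect_sym; last exact: sigp_inj.
  apply: (connect_trans (y := emb r)).
    by apply: connect1; rewrite /= sigp_ext ext_c // rr.
  by rewrite fconnect_sym; [rewrite sigp_ext fconnect_ext|exact: sigp_inj].
by exists Hi; rewrite ?Ip_Hi.
Qed.

Lemma phip_meets x : x != Hi -> exists2 y, y \notin Ip I & fconnect (phip M) x y.
Proof.
have dHo := dec_Ho m; have pI := phim_inj sys.
case: (half_edgeP x) => [h _| |]; first 1 last.
- by rewrite eqxx.
- by exists Ho; rewrite ?Ip_Ho.
have [r rr] := root_some sys h.
case: (dual_cycle_meets r sI aK ax aS tC h) => [[y yI hy]|hr].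
  by exists (emb y); rewrite ?Ip_emb ?(DeltaE rr) // phip_ext fconnect_ext.
exists Ho; rewrite ?Ip_Ho // fconnect_sym; last exact: phip_inj.
apply: (connect_trans (y := emb r)).
  by apply: connect1; rewrite /= phip_ext ext_c // rr.
by rewrite fconnect_sym; [rewrite phip_ext fconnect_ext|exact: phip_inj].
Qed.

Lemma nverts_Psi1 : nverts (Psi1 M S) = m./2.+1.
Proof.
have sysA := Lambda1_system sys Delta_tour_cyclic.
have [tI _ _ rA] := sysA.
rewrite /nverts -(ncyc_ext_Hi tI rA) -(card_Ip sys Delta_swap).
rewrite -(eq_ncyc _ _ _ (taup_ext sys Delta_tour_cyclic)); last first.
- by apply: ext_inj => //; exact: dec_Hi.
- exact: taup_inj.
exact: (unfolded_count (sigp_inj sys) (alppK sys) (Ip_swap Delta_swap)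
  (alpp_Hi M) (Ip_Hi I) sigp_meets).
Qed.

Lemma Psi1_cyclic : cyclic_on (phim (Psi1 M S)).
Proof.
apply/(ext_tour_cyclic (Lambda1_system sys Delta_tour_cyclic)) => x y.
rewrite -(eq_fconnect (f := fun x => taup M I (alpp M x))); first exact: Delta_tour_cyclic.
by move=> z; rewrite (taup_ext sys Delta_tour_cyclic).
Qed.

Lemma Psi1_plane_tree : is_plane_tree (Psi1 M S).
Proof.
have sysA := Lambda1_system sys Delta_tour_cyclic.
have f1 : nfaces (Psi1 M S) = 1 by apply/(nfaces_cyclic sysA); exact: Psi1_cyclic.
split; last by rewrite /has_genus nverts_Psi1 f1 addn0 /nedges addn1 addn2.
by split=> //; apply: is_map_cyclic sysA Psi1_cyclic.
Qed.

Lemma Psi2_map : is_map (Psi2 M S).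
Proof. exact: (Lambda2_map sys Delta_swap Delta_tour_cyclic). Qed.

Lemma Psi2_unicellular : is_unicellular (Psi2 M S).
Proof.
split; first exact: Psi2_map.
apply/(nfaces_cyclic (is_map_system Psi2_map)).
exact: (beta_cyclic sys Delta_swap Delta_tour_cyclic).
Qed.

Lemma Psi2_coloring : proper_coloring (Psi2 M S) (fun x => x \in Ip I).
Proof. exact: (Ip_coloring sys Delta_swap). Qed.

Lemma Psi2_white : ncyc (piL M I) (Ip I) = nverts M.
Proof.
have [_ _ _ rE] := sys.
rewrite /nverts -(ncyc_ext_Hi sI rE); symmetry.
exact: (white_count (sigp_inj sys) (alppK sys) (phip_inj sys) (Ip_swap Delta_swap)
  (alpp_Hi M) (Ip_Hi I) sigp_meets).
Qed.

Lemma Psi2_black : ncyc (piL M I) (~: Ip I) = nfaces M.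
Proof.
have [_ _ _ rE] := sys.
rewrite /nfaces -(ncyc_ext_Ho (phim_inj sys) rE); symmetry.
exact: (black_count (sigp_inj sys) (alppK sys) (phip_inj sys) (Ip_swap Delta_swap)
  (Ip_Hi I) phip_meets).
Qed.

Lemma nverts_Psi2 : nverts (Psi2 M S) = nverts M + nfaces M.
Proof.
rewrite -Psi2_white -Psi2_black /nverts /= -(setUCr (Ip I)).
have [c _] := Psi2_coloring; have pI := piL_inj sys (I := I).
apply: ncyc_setU => // x y xI; rewrite inE => yI; apply: contraNN yI => /iter_findex<-.
by elim: (findex _ _ _) => //= k IH; rewrite [_ \in _]c.
Qed.

(** The unfolded map has v + f vertices, one face and one more edge, so the two Euler relations
    coincide. *)
Lemma genus_Psi2 g : has_genus (Psi2 M S) g <-> has_genus M g.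
Proof.
rewrite /has_genus nverts_Psi2; case: Psi2_unicellular => _ ->.
rewrite -[nedges (Psi2 M S)]/((nedges M).+1) addn1 !addSn.
by split=> [[]|->].
Qed.

Lemma Psi2_color col : proper_coloring (Psi2 M S) col -> col Hi -> col =1 fun x => x \in Ip I.
Proof.
move=> pc ci; apply: (coloring_unique (r := Hi) Psi2_map) => //.
  exact: Psi2_coloring.
by rewrite ci Ip_Hi.
Qed.

End Covered.

(** * Isomorphisms *)

Section Functoriality.
Variables (m : nat) (M M' : rmap m) (l : {perm 'I_m}).
Notation Hi := (Hi m).
Notation Ho := (Ho m).
Notation L := (lift_half l).

Lemma dec_lift x : dec (L x) = omap l (dec x).
Proof.
case: (half_edgeP x) => [h| |]; first by rewrite lift_emb !dec_emb.
  by rewrite lift_none ?dec_Hi.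
by rewrite lift_none ?dec_Ho.
Qed.

Hypothesis la : forall h, l (alpm M h) = alpm M' (l h).

Lemma lift_alpp x : L (alpp M x) = alpp M' (L x).
Proof.
case: (half_edgeP x) => [h| |]; first by rewrite alpp_emb !lift_emb alpp_emb la.
  by rewrite alpp_Hi !lift_none ?dec_Hi ?dec_Ho // alpp_Hi.
by rewrite alpp_Ho !lift_none ?dec_Hi ?dec_Ho // alpp_Ho.
Qed.

Section Theta.
Variables (S S' : {set 'I_m}).
Hypotheses (ls : forall h, l (sigm M h) = sigm M' (l h)) (lS : l @: S = S').
Hypothesis lr : omap l (mroot M) = mroot M'.

Lemma lift_theta h : l (theta M S h) = theta M' S' (l h).
Proof. by rewrite /theta -lS (mem_imset _ _ perm_inj); case: ifP; rewrite ls ?la. Qed.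

Lemma theta_iso_cyclic : cyclic_on (theta M S) -> cyclic_on (theta M' S').
Proof.
move=> tC x y; rewrite -(permKV l x) -(permKV l y).
by rewrite (fconnect_conj perm_inj _ _ lift_theta).
Qed.

Lemma Delta_iso h : cyclic_on (theta M S) -> (l h \in Delta M' S') = (h \in Delta M S).
Proof.
move=> tC; rewrite /Delta -lr; case: (mroot M) => [r|] /=; last by rewrite !inE.
rewrite !inE -{1}lS (mem_imset _ _ perm_inj) /prec -!la.
by rewrite !(findex_conj perm_inj lift_theta).
Qed.

Lemma stable_iso : alpha_stable M S -> alpha_stable M' S'.
Proof.
move=> aS h; rewrite -(permKV l h) -lS -la !(mem_imset _ _ perm_inj).
exact: aS.
Qed.

End Theta.

Hypotheses (sys : half_edge_system M) (sys' : half_edge_system M').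
Let sI : injective (sigm M). Proof. by case: sys. Qed.
Let sI' : injective (sigm M'). Proof. by case: sys'. Qed.

Section Lambda.
Variables (I I' : {set 'I_m}).
Hypotheses (ls : forall h, l (sigm M h) = sigm M' (l h)).
Hypothesis (lr : omap l (mroot M) = mroot M').
Hypothesis lI : forall h, (l h \in I') = (h \in I).

Lemma lift_sigp x : L (sigp M x) = sigp M' (L x).
Proof. by rewrite !sigp_ext; apply: lift_ext => //; apply: dec_Hi. Qed.

Lemma lift_phip x : L (phip M x) = phip M' (L x).
Proof.
rewrite !phip_ext; apply: lift_ext => //; first exact: dec_Ho.
by move=> h; rewrite /phim ls la.
Qed.

Lemma lift_Ip x : (L x \in Ip I') = (x \in Ip I).
Proof.
case: (half_edgeP x) => [h| |]; first by rewrite lift_emb !Ip_emb.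
  by rewrite lift_none ?dec_Hi // !Ip_Hi.
by rewrite lift_none ?dec_Ho // (negPf (Ip_Ho _)) (negPf (Ip_Ho _)).
Qed.

Lemma lift_pic x : L (pic M I x) = pic M' I' (L x).
Proof. exact: restr_conj (sigp_inj sys) (sigp_inj sys') lift_sigp lift_Ip x. Qed.

Lemma lift_pib x : L (pib M I x) = pib M' I' (L x).
Proof.
apply: restr_conj (phip_inj sys) (phip_inj sys') lift_phip _ x => y.
by rewrite !in_setC lift_Ip.
Qed.

Lemma lift_piL x : L (piL M I x) = piL M' I' (L x).
Proof.
rewrite /piL lift_pic; congr (pic M' I' _); apply: finv_conj x; last exact: lift_pib.
  exact: restr_inj (phip_inj sys).
exact: restr_inj (phip_inj sys').
Qed.

Lemma lift_taup x : L (taup M I x) = taup M' I' (L x).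
Proof.
rewrite /taup lift_sigp; congr (sigp M' _); apply: finv_conj x; last exact: lift_pic.
  exact: restr_inj (sigp_inj sys).
exact: restr_inj (sigp_inj sys').
Qed.

Lemma Lambda1_iso : map_iso (Lambda1 M I) (Lambda1 M' I').
Proof.
exists l; split=> //= [h|].
  have E := emb_erase (taup_inj sys (I := I)) h.
  have E' := emb_erase (taup_inj sys' (I := I')) (l h).
  apply: emb_inj; rewrite -lift_emb [emb (tauL M I h)]E [RHS]E' -lift_emb.
  apply: (restr_conj (taup_inj sys (I := I)) (taup_inj sys' (I := I')) lift_taup).
  exact: lift_Hset.
by rewrite -dec_lift lift_taup lift_none // dec_Hi.
Qed.

Lemma Lambda2_iso : map_iso (Lambda2 M I) (Lambda2 M' I').
Proof.
exists (perm (lift_half_inj (l := l))); split=> [h|h|] /=; rewrite ?permE.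
- exact: lift_piL.
- exact: lift_alpp.
by rewrite lift_none // dec_Hi.
Qed.

End Lambda.
End Functoriality.

(** The orientation depends on the unfolded tree alone: it has at most one ingoing half-edge per
    cycle of [taup], which by [downward_char] forces it. *)
Lemma Ip_downward m (M : rmap m) (S : {set 'I_m}) : is_map M -> alpha_stable M S ->
  cyclic_on (theta M S) ->
  Ip (Delta M S) = downward (taup M (Delta M S)) (alpp M) (Ho m).
Proof.
move=> hM aS tC; have sys := is_map_system hM.
apply: (downward_char (i := Hi m)).
- exact: taup_inj.
- exact: alppK.
- exact: alpp_neq.
- exact: alpp_Hi.
- exact: taup_Ho.
- exact: Delta_tour_cyclic.
- exact: (Ip_swap (Delta_swap hM aS tC)).
- exact: (unfolded_one_per_cycle (sigp_inj sys)).
- exact: Ip_Hi.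
Qed.

(** * Injectivity of the unfolding *)

Section Injectivity.
Variables (m : nat) (M M' : rmap m) (S S' : {set 'I_m}).
Notation Hi := (Hi m).
Notation Ho := (Ho m).
Hypotheses (hM : is_map M) (hM' : is_map M').
Hypotheses (aS : alpha_stable M S) (aS' : alpha_stable M' S').
Hypotheses (tC : cyclic_on (theta M S)) (tC' : cyclic_on (theta M' S')).
Let sys := is_map_system hM.
Let sys' := is_map_system hM'.
Notation I := (Delta M S).
Notation I' := (Delta M' S').

Variables (l : {perm 'I_m}) (q : {perm 'I_m.+2}).
Hypotheses (lt : forall h, l (tauL M I h) = tauL M' I' (l h))
  (la : forall h, l (alpm M h) = alpm M' (l h))
  (lr : omap l (mroot (Psi1 M S)) = mroot (Psi1 M' S'))
  (qp : forall x, q (piL M I x) = piL M' I' (q x))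
  (qa : forall x, q (alpp M x) = alpp M' (q x)) (qi : q Hi = Hi).
Notation L := (lift_half l).
Notation beta := (fun x => piL M I (alpp M x)).
Notation beta' := (fun x => piL M' I' (alpp M' x)).

Let aI := Ip_swap (Delta_swap hM aS tC).
Let aI' := Ip_swap (Delta_swap hM' aS' tC').
Let aD := Delta_swap hM aS tC.
Let aD' := Delta_swap hM' aS' tC'.

Lemma lift_tree x : L (taup M I x) = taup M' I' (L x).
Proof.
have dHi := dec_Hi m.
rewrite (taup_ext sys (Delta_tour_cyclic hM aS tC)).
rewrite (taup_ext sys' (Delta_tour_cyclic hM' aS' tC')).
exact: lift_ext.
Qed.

Lemma lift_tree_Ip x : (L x \in Ip I') = (x \in Ip I).
Proof.
rewrite (Ip_downward hM aS tC) (Ip_downward hM' aS' tC') !inE /tidx -(lift_alpp la).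
have Lo : L Ho = Ho by rewrite lift_none ?dec_Ho.
have cT y : fconnect (fun z => taup M I (alpp M z)) Ho y.
  exact: Delta_tour_cyclic.
have E y : findex (fun z => taup M' I' (alpp M' z)) Ho (L y) =
           findex (fun z => taup M I (alpp M z)) Ho y.
  rewrite -{1}Lo; refine (findex_conj (@lift_half_inj _ l) _ (cT y)).
  by move=> z; rewrite lift_tree (lift_alpp la).
by rewrite !E.
Qed.

(** The pulled-back colouring is proper and agrees at the root, so it is the only such colouring. *)
Lemma face_Ip x : (q x \in Ip I') = (x \in Ip I).
Proof.
have [c1 c2] := Psi2_coloring hM' aS' tC'.
apply: (Psi2_color hM aS tC (col := fun x => q x \in Ip I')); last by rewrite /= qi Ip_Hi.
by split=> y /=; rewrite ?qp ?qa; [exact: c1|exact: c2].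
Qed.

(* Both isomorphisms transport the tour of the tree on edges, which by
   [tour_face] is the reverse face tour of the bipartite map; they agree at the root. *)
Lemma isos_agree x : L x = q x.
Proof.
wlog xI : x / x \in Ip I.
  move=> H; have [xI|xI] := boolP (x \in Ip I); first exact: H.
  apply: (inv_inj (alppK sys')); rewrite -(lift_alpp la) -qa; apply: H.
  by rewrite aI.
have /iter_findex := beta_cyclic sys aD (Delta_tour_cyclic hM aS tC) x Hi.
move: (findex _ _ _) => k; have [n] := ubnP k; elim: n k x xI => // n IH [|[|k]] x xI.
- by move=> _ /= ->; rewrite lift_none ?dec_Hi.
- by move=> _ /= E; have := Ip_Hi I; rewrite -E (piL_color sys aD) aI xI.
rewrite ltnS => kn; rewrite !iterSr => E.
have bI : beta (beta x) \in Ip I by rewrite /= !(piL_color sys aD, aI) ?xI.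
have {IH E} Eb := IH k _ bI (ltnW kn) E.
have qxI : q x \in Ip I' by rewrite face_Ip.
(* [piL_tour] recovers the opposite of [x] from two face steps: [L] transports the tree tour, and by
   induction agrees with [q] after those two steps. *)
apply: (inv_inj (alppK sys')); rewrite -(lift_alpp la).
rewrite -(piL_tour sys aD xI) -(piL_tour sys' aD' qxI).
rewrite (restr_conj (taup_alpp_inj sys (I := I)) (taup_alpp_inj sys' (I := I')) (S' := ~: Ip I')).
- by rewrite (lift_alpp la) Eb /= !(qp, qa).
- by move=> z; rewrite lift_tree (lift_alpp la).
by move=> z; rewrite !in_setC lift_tree_Ip.
Qed.

(** [sigp] is [taup] after [pic]; [L] transports the former, [q] the latter, and they agree. *)
Lemma lift_sigp_psi x : L (sigp M x) = sigp M' (L x).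
Proof.
rewrite -(taup_pic sys I) -(taup_pic sys' I') lift_tree; congr (taup M' I' _).
have [xI|xI] := boolP (x \in Ip I); last by rewrite /pic !restr_out ?lift_tree_Ip.
have qxI : q x \in Ip I' by rewrite face_Ip.
by rewrite -piL_white // !isos_agree qp -piL_white.
Qed.

Lemma Psi_injective : covered_iso M S M' S'.
Proof.
have sI : injective (sigm M) by case: hM.
have sI' : injective (sigm M') by case: hM'.
have [ls lrr] := unlift_ext sI sI' (dec_Hi m) lift_sigp_psi.
exists l; split=> //.
(* The image of [S] under [l] and [S'] are compared on the same map [M'], where their orientations
   coincide. *)
have tC'' := theta_iso_cyclic la ls (erefl (l @: S)) tC.
have aS'' := stable_iso la (erefl (l @: S)) aS.
have DE : Delta M' (l @: S) = Delta M' S'.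
  apply/setP=> h; rewrite -(permKV l h) (Delta_iso la ls erefl lrr _ tC).
  by rewrite -Ip_emb -lift_tree_Ip lift_emb Ip_emb.
apply/setP=> h; have [r rr] := root_some sys' h.
have [_ aK ax _] := sys'.
rewrite (DeltaE _ rr) (DeltaE _ rr) in DE.
by rewrite (ingoing_determines ax aS'' aS' tC'' tC' DE).
Qed.

End Injectivity.

(** * Folding a tree and a bipartite unicellular map *)

Section OrbitTransport.
Variables (T U : finType) (f : T -> T) (g : U -> U) (x0 : T) (y0 : U).
Hypotheses (fI : injective f) (gI : injective g) (fg : order f x0 = order g y0).

Definition orbit_map x := iter (findex f x0 x) g y0.

(** At the last point of the orbit the index falls back to 0; equal orders make [g] close up there
    as well. *)
Lemma orbit_map_step x : fconnect f x0 x -> orbit_map (f x) = g (orbit_map x).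
Proof.
move=> x0x; rewrite /orbit_map; set k := findex f x0 x.
have fx : f x = iter k.+1 f x0 by rewrite /= iter_findex.
have := findex_max x0x; rewrite -/k leq_eqVlt => /orP[/eqP kE|kl].
  have -> : f x = x0 by rewrite fx kE iter_order.
  by rewrite findex0 -iterS kE fg iter_order.
by rewrite fx findex_iter.
Qed.

Lemma orbit_map_inj x y : fconnect f x0 x -> fconnect f x0 y ->
  orbit_map x = orbit_map y -> x = y.
Proof.
move=> x0x x0y /(congr1 (findex g y0)).
rewrite /orbit_map !findex_iter -?fg ?findex_max // => E.
by rewrite -(iter_findex x0x) E iter_findex.
Qed.

Lemma orbit_map_connect x : fconnect g y0 (orbit_map x).
Proof. exact: fconnect_iter. Qed.

End OrbitTransport.

Lemma fconnect_square (T : finType) (f : T -> T) (C : {set T}) :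
  (forall x, (f x \in C) = (x \notin C)) -> cyclic_on f ->
  {in C &, forall x y, fconnect (f \o f) x y}.
Proof.
move=> fC cf x y xC yC; have /iter_findex := cf x y.
move: (findex _ _ _) => k; have [n] := ubnP k; elim: n k x xC => // n IH [|[|k]] x xC.
- by move=> _ /= ->.
- by move=> _ /= E; move: yC; rewrite -E fC xC.
rewrite ltnS => kn; rewrite !iterSr => E.
apply: connect_trans (fconnect1 (f \o f) x) _.
by apply: IH (ltnW kn) E; rewrite !fC xC.
Qed.

Section Folding.
Variables (m : nat) (T : rmap m) (B : rmap m.+2).
Notation Hi := (Hi m).
Notation Ho := (Ho m).
Hypotheses (hT : is_plane_tree T) (hB : is_unicellular B).
Variables (col : 'I_m.+2 -> bool) (rho : 'I_m.+2).
Hypotheses (pc : proper_coloring B col) (rB : mroot B = Some rho).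

Let mapT : is_map T. Proof. by case: hT => -[]. Qed.
Let mapB : is_map B. Proof. by case: hB. Qed.
Let sysT := is_map_system mapT.
Let sysB := is_map_system mapB.
Let tau := ext (sigm T) (mroot T) Hi.
Let a := alpp T.
Let t x := tau (a x).
Let tauI : injective tau := sigp_inj sysT.
Let aK : involutive a := alppK sysT.
Let ai : a Hi = Ho := alpp_Hi T.
Let tauo : tau Ho = Ho := ext_Ho _ _.
Let tI : injective t := ext_tour_inj sysT.

Let tC : cyclic_on t.
Proof. by apply/(ext_tour_cyclic sysT)/(nfaces_cyclic sysT); case: hT => -[]. Qed.

Let D := downward tau a Ho.
Let aD : forall x, (a x \in D) = (x \notin D) := downward_swap Ho aK (alpp_neq sysT) tC.
Let Di : Hi \in D := downward_i (alpp_neq sysT) ai tC.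
Let Do : Ho \notin D := downward_o tau a Ho.

Let dU : one_per_cycle tau D.
Proof.
apply: (downward_unique tauI aK (alpp_neq sysT) tauo tC).
have [sI _ _ rE] := sysT; rewrite (ncyc_ext_Hi sI rE) card_ord -[RHS]/(m./2.+1).
case: hT => -[_ fT]; rewrite /has_genus fT addn0 /nedges addn1 addn2 => -[].
by rewrite /nverts => ->.
Qed.

Let C := [set x | col x == col rho].
Let sB := sigm B.
Let aB := alpm B.
Let bB := phim B.

Let sBI : injective sB. Proof. by case: sysB. Qed.
Let aBK : involutive aB. Proof. by case: sysB. Qed.
Let bBI : injective bB := phim_inj sysB.
Let bBC : cyclic_on bB. Proof. by apply/(nfaces_cyclic sysB); case: hB. Qed.

Let sC x : (sB x \in C) = (x \in C). Proof. by case: pc => c1 _; rewrite !inE c1. Qed.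
Let aC x : (aB x \in C) = (x \notin C).
Proof.
case: pc => _ /(_ x); rewrite !inE -/aB.
by case: (col (aB x)); case: (col x); case: (col rho).
Qed.
Let bC x : (bB x \in C) = (x \notin C). Proof. exact: etrans (sC _) (aC _). Qed.
Let rC : rho \in C. Proof. by rewrite inE. Qed.

(** By [tour_face], unfolding makes [E] the inverse of two face steps; [gam] is that inverse in [B],
    so gluing must carry [E] to [gam]. *)
Let E x := a (restr t (~: D) (a x)).
Let gam := finv (bB \o bB).

Let EI : injective E.
Proof. by move=> x y /(inv_inj aK)/(restr_inj tI)/(inv_inj aK). Qed.
Let bbI : injective (bB \o bB). Proof. by move=> x y /bBI/bBI. Qed.
Let gamI : injective gam := finv_inj bbI.

Let ED x : (E x \in D) = (x \in D).
Proof. by rewrite /E aD -in_setC restr_inE // in_setC -aD aK. Qed.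

Let Econn x : x \in D -> fconnect E Hi x.
Proof.
move=> xD; have : fconnect (restr t (~: D)) (a Hi) (a x).
  by rewrite restr_connect // ?in_setC aD negbK.
rewrite -(fconnect_conj (l := a) (inv_inj aK) (f := E) (g := restr t (~: D))) //.
by move=> y; rewrite /E aK.
Qed.

Let gamC x : (gam x \in C) = (x \in C).
Proof. by rewrite -{2}(f_finv bbI x) /= !bC negbK. Qed.

Let gconn x : fconnect gam rho x = (x \in C).
Proof.
apply/idP/idP => [/iter_findex<-|xC].
  by elim: (findex _ _ _) => //= k; rewrite gamC.
by rewrite connect_finv //; apply: (fconnect_square bC bBC).
Qed.

Let EgC : order E Hi = order gam rho.
Proof.
have oE : order E Hi = #|D|.
  apply: eq_card => x; rewrite inE; apply/idP/idP => [/iter_findex<-|/Econn//].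
  by elim: (findex _ _ _) => //= k; rewrite ED.
have oG : order gam rho = #|C| by apply: eq_card => x; rewrite inE gconn.
rewrite oE oG -[LHS]doubleK -[RHS]doubleK.
by rewrite (card_swapped aK aD) (card_swapped aBK aC).
Qed.

Let q0 := orbit_map E gam Hi rho.

(* Glue the edges of [B], in reverse face order, to those of [T] in the order of its tour. *)
Definition glue_fun x := if x \in D then q0 x else aB (q0 (a x)).

Let q0C x : q0 x \in C. Proof. by rewrite -gconn; apply: orbit_map_connect. Qed.

Let glueC x : (glue_fun x \in C) = (x \in D).
Proof. by rewrite /glue_fun; case: ifP => _; rewrite ?aC q0C. Qed.

Lemma glue_inj : injective glue_fun.
Proof.
move=> x y xy; have xyD : (x \in D) = (y \in D) by rewrite -(glueC x) xy glueC.
move: xy; rewrite /glue_fun -xyD; case: ifP => xD.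
  by move=> qxy; apply: (orbit_map_inj EgC _ _ qxy); apply: Econn; rewrite -?xyD.
move=> /(inv_inj aBK) qxy; apply: (inv_inj aK).
by apply: (orbit_map_inj EgC _ _ qxy); apply: Econn; rewrite aD -?xyD xD.
Qed.

Let q := perm glue_inj.

Let q_a x : q (a x) = aB (q x).
Proof.
rewrite !permE /glue_fun aD; case: ifP => [xD|xD]; first by rewrite (negPf xD) aBK.
by move/negbFE: xD => xD; rewrite xD aK.
Qed.

Let q_i : q Hi = rho.
Proof. by rewrite permE /glue_fun Di /q0 /orbit_map findex0. Qed.

Let q_C x : (q x \in C) = (x \in D). Proof. by rewrite permE glueC. Qed.

Let q_E x : x \in D -> q (E x) = gam (q x).
Proof.
move=> xD; rewrite !permE /glue_fun ED xD.
by apply: (orbit_map_step EI gamI EgC); apply: Econn.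
Qed.

(** The prescribed pi_white, read off from the white vertices of [B] through the gluing;
    [fold_sigma] then inverts the definition of tau'. *)
Definition fold_white x := if x \in D then (q^-1)%g (sB (q x)) else x.
Notation pw := fold_white.

Let pwD x : (pw x \in D) = (x \in D).
Proof.
rewrite /pw; case: ifP => // xD.
by rewrite -q_C permKV sC q_C.
Qed.

Let pwI : injective pw.
Proof.
move=> x y xy; have xyD : (x \in D) = (y \in D) by rewrite -(pwD x) xy pwD.
by move: xy; rewrite /pw -xyD; case: ifP => // _ /perm_inj/sBI/perm_inj.
Qed.

Definition fold_sigma x := tau (pw x).
Notation s := fold_sigma.

Let sI : injective s. Proof. by move=> x y /tauI/pwI. Qed.
Let so : s Ho = Ho. Proof. by rewrite /s /pw (negPf Do). Qed.

Let si : 0 < m -> s Hi != Hi.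
Proof.
move=> mP; apply/eqP => si; have xD : pw Hi \in D by rewrite pwD.
(* [tau] would send [pw Hi] to [Hi], and a cycle has only one downward half-edge. *)
have xi : pw Hi = Hi by apply: dU => //; rewrite -{2}si; apply: fconnect1.
have [_ _ _] := sysT; rewrite mP; case rr : (mroot T) => [r|] // _.
move/eqP: si; rewrite /s xi /tau ext_c ?dec_Hi // rr.
by rewrite emb_neq // dec_Hi.
Qed.

Definition fold_map : rmap m := RMap (erase s) (alpm T) (dec (s Hi)).
Notation M := fold_map.

Lemma fold_system : half_edge_system M.
Proof.
have [_ aTK aTx _] := sysT; split=> //; first exact: erase_inj.
exact: dec_root.
Qed.

Let sysM := fold_system.

Let sigpM : sigp M =1 s. Proof. by move=> x; symmetry; exact: (ext_erase sI so si). Qed.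

Definition fold_in : {set 'I_m} := [set h | emb h \in D].
Notation I := fold_in.

Let IpD : Ip I = D.
Proof.
apply/setP=> x; case: (half_edgeP x) => [h| |].
- by rewrite Ip_emb in_set.
- by rewrite Ip_Hi Di.
by rewrite (negPf (Ip_Ho _)) (negPf Do).
Qed.

Let inI h : (h \in I) = (emb h \in D). Proof. by rewrite in_set. Qed.

Let aI h : (alpm M h \in I) = (h \notin I).
Proof. by rewrite !inI -aD /a alpp_emb. Qed.

Let restr_tau x : x \in D -> restr tau D x = x.
Proof.
move=> xD; symmetry; apply: dU => //; first exact: restr_in.
by rewrite -(restr_connect tauI xD) ?restr_in // fconnect1.
Qed.

(** Off [D] the folded sigma is [tau], whose first return to [D] is the identity, so from
    [tau (pw x)] it first meets [D] at [pw x]. *)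
Let picM x : pic M I x = pw x.
Proof.
rewrite /pic IpD (eq_restr _ sigpM); have [xD|xD] := boolP (x \in D); last first.
  by rewrite restr_out // /pw (negPf xD).
apply: restr_eq => //; have pD : pw x \in D by rewrite pwD.
have := restr_hit tauI pD; rewrite restr_tau //.
by apply: hit_eq_off => y yD; rewrite /s /pw (negPf yD).
Qed.

Let taupM x : taup M I x = tau x.
Proof.
have pI : injective (pic M I) by apply: restr_inj; apply: sigp_inj.
by rewrite -(f_finv pI x) taup_pic // picM sigpM.
Qed.

Lemma fold_Lambda1 : map_iso (Lambda1 M I) T.
Proof.
have [sTI _ _ rT] := sysT; exists 1%g; split=> [h|h|]; rewrite ?perm1 //=.
  apply: emb_inj; have -> := emb_erase (taup_inj sysM (I := I)) h.
  by rewrite (eq_restr _ taupM) restr_ext // dec_Hi.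
rewrite taupM /tau ext_c ?dec_Hi //; case: (mroot T) => [r|] /=; last by rewrite dec_Hi.
by rewrite dec_emb /= perm1.
Qed.

Lemma fold_Lambda2 : map_iso (Lambda2 M I) B.
Proof.
exists q; split=> [x|x|] /=; [|exact: q_a|by rewrite q_i rB].
have white y : y \in D -> q (piL M I y) = sB (q y).
  by move=> yD; rewrite piL_white ?IpD // picM /pw yD permKV.
have [xD|xD] := boolP (x \in D); first exact: white.
pose y := a x; have yD : y \in D by rewrite aD.
have xE : x = a y by rewrite aK.
have yI : y \in Ip I by rewrite IpD.
(* Black vertices are not imposed by the construction: two face steps from [y] match two in [B] by
   [q_E], the second is a white step already treated, and cancelling it leaves the black one. *)
have Eb : E (piL M I (a (piL M I (a y)))) = y.
  have := piL_tour sysM aI yI; rewrite -/a /E IpD => tf.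
  rewrite (eq_restr (g := fun z => taup M I (a z))); last by move=> z; rewrite taupM.
  by rewrite [restr _ _ _]tf aK.
have bD : piL M I (a y) \notin D by rewrite -IpD piL_color // IpD -xE.
have abD : a (piL M I (a y)) \in D by rewrite aD.
have wD : piL M I (a (piL M I (a y))) \in D by rewrite -IpD piL_color // IpD.
have := q_E wD; rewrite Eb => /(congr1 (bB \o bB)); rewrite f_finv // white // q_a.
by move=> /bBI bq; rewrite xE q_a -bq.
Qed.

Lemma fold_covered : exists S : {set 'I_m},
  [/\ alpha_stable M S, cyclic_on (theta M S) & Delta M S = I].
Proof.
have [sMI aMK aMx rM] := sysM.
case rr : (mroot M) => [r|]; last first.
  have m0 : m = 0 by apply/eqP; rewrite eqn0Ngt -rM rr.
  have no (h : 'I_m) : False by case: h => k; rewrite m0.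
  by exists set0; split=> [h|h|]; [case: (no h)|case: (no h)|apply/setP=> h; case: (no h)].
case: (orientation_realized (r := r) sMI aMK aMx aI) => [P Pa Ps h|S [aS cS DS]]; last first.
  by exists S; split=> //; rewrite (DeltaE _ rr).
(* [left_ind] comes from [downward_ind]: on outgoing half-edges the folded sigma is [tau], and the
   value [true] on the root edge accounts for the alternative [s x == r]. *)
pose P' x := if dec x is Some h then P h else true.
have P'E k : P' (emb k) = P k by rewrite /P' dec_emb.
rewrite -P'E; apply: (downward_ind tauI aK ai tauo tC dU) => {h}.
- by rewrite /P' dec_Hi.
- move=> x; case: (half_edgeP x) => [h| |]; first by rewrite /a alpp_emb !P'E; exact: Pa.
    by rewrite /a alpp_Hi /P' dec_Ho.
  by rewrite /a alpp_Ho /P' dec_Hi.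
move=> x; case: (half_edgeP x) => [h| |]; [|by rewrite /P' dec_Hi|by rewrite /P' dec_Ho].
move=> hD; have -> : tau (emb h) = sigp M (emb h) by rewrite sigpM /s /pw (negPf hD).
rewrite sigp_ext ext_emb P'E => Ph; apply: Ps; first by rewrite inI.
move: Ph; rewrite rr; case: eqP => [[sr] _|_]; last by rewrite P'E => ->.
by apply/orP; right; apply/eqP.
Qed.

End Folding.

(** * Surjectivity and the bijection *)

Lemma theta_map m (M : rmap m) (S : {set 'I_m}) : half_edge_system M ->
  cyclic_on (theta M S) -> is_map M.
Proof.
move=> [sI aK ax rE] tC; split=> // x y; have /iter_findex<- := tC x y.
elim: (findex _ _ _) => [|k IH] /=; first exact: connect0.
apply: connect_trans IH _; move: (iter k _ _) => h; rewrite /theta; case: ifP => _.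
  apply: (connect_trans (connect1 _) (connect1 _)).
    by apply/orP; right; apply: eqxx.
  by apply/orP; left; apply: eqxx.
by apply: connect1; apply/orP; left; apply: eqxx.
Qed.

Lemma nverts_iso m (M M' : rmap m) : half_edge_system M -> half_edge_system M' ->
  map_iso M M' -> nverts M = nverts M'.
Proof.
move=> [sI _ _ _] [sI' _ _ _] [l [ls _ _]]; rewrite /nverts; case: ifP => // _; symmetry.
apply: (ncyc_conj (l := l)) => //; first by move=> x y _ _; apply: (fconnect_conj perm_inj).
by move=> y _; exists ((l^-1)%g y); rewrite ?inE // permKV.
Qed.

Lemma Psi_surjective m (T : rmap m) (B : rmap m.+2) g :
  is_plane_tree T -> is_bipartite B -> is_unicellular B -> has_genus B g ->
  exists M S, [/\ is_covered M S /\ has_genus M g,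
    map_iso (Psi1 M S) T & map_iso (Psi2 M S) B].
Proof.
move=> hT [mB [col pc]] hB gB; have sysB := is_map_system mB.
have [rho rB] := root_some sysB ord0.
have [S [aS tS DS]] := fold_covered hT hB rho pc.
have sysM := fold_system hT hB rho pc.
have iso1 := fold_Lambda1 hT hB rho pc.
have iso2 := fold_Lambda2 hT hB pc rB.
move: S aS tS DS sysM iso1 iso2; set M := fold_map hT hB rho pc => S aS tS DS sysM.
(* Transitivity of the folded map is obtained only here, from the cyclicity of its motion
   function. *)
rewrite -DS => iso1 iso2; have mapM := theta_map sysM tS.
exists M, S; split=> //; split; first exact/(covered_theta mapM aS).
apply/(genus_Psi2 mapM aS tS).
have [mapP fP] := Psi2_unicellular mapM aS tS.
move: gB; rewrite /has_genus fP (nverts_iso (is_map_system mapP) sysB iso2).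
by have [_ ->] := hB.
Qed.

Theorem mainTheorem1 (n g : nat) :
  [/\ (* Psi lands in the right classes *)
      (forall (M : rmap n.*2) S, covered_ng g M S ->
         [/\ is_plane_tree (Psi1 M S), is_bipartite (Psi2 M S),
             is_unicellular (Psi2 M S) & has_genus (Psi2 M S) g]),
      (* Psi is well defined on isomorphism classes *)
      (forall (M M' : rmap n.*2) S S', covered_ng g M S -> covered_ng g M' S' ->
         covered_iso M S M' S' ->
         map_iso (Psi1 M S) (Psi1 M' S') /\ map_iso (Psi2 M S) (Psi2 M' S')),
      (* injective on isomorphism classes *)
      (forall (M M' : rmap n.*2) S S', covered_ng g M S -> covered_ng g M' S' ->
         map_iso (Psi1 M S) (Psi1 M' S') -> map_iso (Psi2 M S) (Psi2 M' S') ->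
         covered_iso M S M' S'),
      (* surjective on isomorphism classes *)
      (forall (T : rmap n.*2) (B : rmap n.+1.*2),
         is_plane_tree T -> is_bipartite B -> is_unicellular B -> has_genus B g ->
         exists M S, [/\ covered_ng g M S, map_iso (Psi1 M S) T & map_iso (Psi2 M S) B])
    & (* white/black vertex counts *)
      (forall (M : rmap n.*2) S, covered_ng g M S ->
         forall col, proper_coloring (Psi2 M S) col ->
           oapp col true (mroot (Psi2 M S)) = true ->
           ncol_verts (Psi2 M S) col true = nverts M /\
           ncol_verts (Psi2 M S) col false = nfaces M)].
Proof.
have cov m (M : rmap m) S : is_covered M S ->
    [/\ is_map M, alpha_stable M S & cyclic_on (theta M S)].
  by move=> cM; have [mM aS _ _ _] := cM; split=> //; apply/covered_theta.
split.
- move=> M S [/cov[mM aS tC] gM]; split.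
  + exact: Psi1_plane_tree.
  + split; first exact: Psi2_map.
    by exists (fun x => x \in Ip (Delta M S)); apply: Psi2_coloring.
  + exact: Psi2_unicellular.
  + exact/genus_Psi2.
- move=> M M' S S' [/cov[mM aS tC] _] [/cov[mM' aS' tC'] _] [l [ls la lr lS]].
  have sys := is_map_system mM; have sys' := is_map_system mM'.
  have lD h := Delta_iso la ls lS lr h tC.
  split; first exact: (Lambda1_iso la sys sys' ls lr lD).
  exact: (Lambda2_iso la sys sys' ls lr lD).
- move=> M M' S S' [/cov[mM aS tC] _] [/cov[mM' aS' tC'] _].
  move=> [l [lt la lr]] [q [qp qa [qi]]].
  exact: (Psi_injective mM mM' aS aS' tC tC' lt la lr qp qa qi).
- by move=> T B; apply: Psi_surjective.
move=> M S [/cov[mM aS tC] _] col pc /= ci.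
have cE := Psi2_color mM aS tC pc ci.
rewrite -(Psi2_white mM aS tC) -(Psi2_black mM aS tC) /ncol_verts.
split; congr ncyc; apply/setP=> x; rewrite in_set cE ?in_setC; first exact: eqb_id.
exact: eqbF_neg.
Qed.
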